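(* Let $\varepsilon>0$, let $\lambda>3$ be any real number with $\log\lambda<\log 3+\varepsilon$, and let $F_\varepsilon\colon\mathbb{R}\to\mathbb{R}$ be the piecewise affine map associated with $\lambda$ that is defined in the context. Then $F_\varepsilon$ is a mixing map of the real line with the usual metric which does not have the specification property, but there exists a continuous map $f_\varepsilon\colon(0,1)\to(0,1)$ which has the specification property (with respect to the usual metric on $(0,1)$) and is topologically conjugate to $F_\varepsilon$.
   Context: Construction of $F_\varepsilon$. Given $\lambda>3$, put $p_1=\frac1\lambda$, $q_1=\frac{\lambda+1}{4\lambda}$, $p_2=\frac{\lambda-1}{2\lambda}$, $p_3=\frac{\lambda+1}{2\lambda}$, $q_2=\frac{3\lambda-1}{4\lambda}$, $p_4=\frac{\lambda-1}{\lambda}$ (so $0<p_1<q_1<p_2<p_3<q_2<p_4<1$), and define $\varphi_\varepsilon\colon[0,1]\to\mathbb{R}$ by $$\varphi_\varepsilon(x)=\begin{cases}1-\lambda x,& x\in[0,p_1],\\ \frac1\lambda-x,& x\in[p_1,q_1],\\ x-\frac{\lambda-1}{2\lambda},& x\in[q_1,p_2],\\ \lambda x-\frac{\lambda-1}{2},& x\in[p_2,p_3],\\ x+\frac{\lambda-1}{2\lambda},& x\in[p_3,q_2],\\ \frac{2\lambda-1}{\lambda}-x,& x\in[q_2,p_4],\\ \lambda-\lambda x,& x\in[p_4,1].\end{cases}$$ Then $$F_\varepsilon(x)=\begin{cases}-x,& x>0,\\ \varphi_\varepsilon(x-\lfloor x\rfloor)-\lfloor x\rfloor-1,& x\le 0,\end{cases}$$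 where $\lfloor x\rfloor$ is the largest integer $\le x$. Definitions. A continuous map $f\colon X\to X$ of a metric space $(X,d)$ is (topologically) mixing if for all nonempty open $U,V\subset X$ there is a positive integer $N$ such that $f^n(U)\cap V\neq\emptyset$ for all $n\ge N$. It has the specification property if for every $\delta>0$ there is an integer $N_\delta>0$ such that for every integer $s\ge2$, all points $y_1,\dots,y_s\in X$, and all integers $0=j_1\le k_1<j_2\le k_2<\dots<j_s\le k_s$ with $j_{l+1}-k_l\ge N_\delta$ for $l=1,\dots,s-1$, there is a point $x\in X$ such that $d(f^i(x),f^i(y_m))<\delta$ for each $1\le m\le s$ and every $i$ with $j_m\le i\le k_m$. Maps $f\colon X\to X$ and $g\colon Y\to Y$ are conjugate if there is a homeomorphism $\theta\colon Y\to X$ with $\theta\circ g=f\circ\theta$. *)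

(* Defs.v *)
From HB Require Import structures.
From mathcomp Require Import all_boot all_order all_algebra.
From mathcomp Require Import all_classical all_reals all_analysis.

Set Implicit Arguments.
Unset Strict Implicit.
Unset Printing Implicit Defensive.

Import Order.TTheory GRing.Theory Num.Theory.
Import numFieldNormedType.Exports.

Local Open Scope classical_set_scope.
Local Open Scope ring_scope.

(* The library gives a subset A of X the induced topology and balls (as the
   type set_type A), but no distance: this adds the induced distance. *)
Section subset_metric.
Context {R : realType} {X : metricType R} (A : set X).

Let dist (x y : set_type A) : R := mdist (set_val x) (set_val y).

Let dist_ge0 x y : 0 <= dist x y.
Proof. exact: mdist_ge0. Qed.

Let dist_positivity x y : dist x y = 0 -> x = y.
Proof. by move=> /mdist_positivity /val_inj. Qed.

Let ballEdist x e : ball x e = [set y | dist x y < e].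
Proof. by rewrite -initial_ballE ballEmdist. Qed.

HB.instance Definition _ := PseudoMetric_isMetric.Build R (set_type A)
  dist_ge0 dist_positivity ballEdist.

End subset_metric.

Section dynamics.
Context {R : realType}.

(* Continuity of f is not part of the next two definitions. *)
Definition mixing {X : metricType R} (f : X -> X) : Prop :=
  forall U V : set X, open U -> open V -> U !=set0 -> V !=set0 ->
  exists2 N : nat, (0 < N)%N &
    forall n : nat, (N <= n)%N -> (iter n f @` U) `&` V !=set0.

(* The s-tuples (y_l), (j_l), (k_l), 1 <= l <= s, are given as functions on nat
   of which only the values at 1, ..., s matter. *)
Definition specification_property {X : metricType R} (f : X -> X) : Prop :=
  forall delta : R, 0 < delta ->
  exists2 N : nat, (0 < N)%N &
    forall (s : nat) (y : nat -> X) (j k : nat -> nat),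
      (2 <= s)%N ->
      j 1%N = 0%N ->
      (forall l, (1 <= l <= s)%N -> (j l <= k l)%N) ->
      (forall l, (1 <= l < s)%N -> (k l < j l.+1)%N) ->
      (forall l, (1 <= l < s)%N -> (N <= j l.+1 - k l)%N) ->
      exists x : X, forall m i : nat,
        (1 <= m <= s)%N -> (j m <= i <= k m)%N ->
        mdist (iter i f x) (iter i f (y m)) < delta.

Definition homeomorphism {X Y : topologicalType} (theta : Y -> X) : Prop :=
  continuous theta /\
  exists theta' : X -> Y,
    [/\ continuous theta', cancel theta theta' & cancel theta' theta].

Definition conjugate {X Y : topologicalType} (f : X -> X) (g : Y -> Y) : Prop :=
  exists2 theta : Y -> X, homeomorphism theta & theta \o g = f \o theta.

End dynamics.

Section the_map.
Context {R : realType}.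
Implicit Types lam x : R.

Definition p1 lam := 1 / lam.
Definition q1 lam := (lam + 1) / (4 * lam).
Definition p2 lam := (lam - 1) / (2 * lam).
Definition p3 lam := (lam + 1) / (2 * lam).
Definition q2 lam := (3 * lam - 1) / (4 * lam).
Definition p4 lam := (lam - 1) / lam.

(* Meant for x in [0, 1], where 0 < p1 < q1 < p2 < p3 < q2 < p4 < 1 for lam > 3;
   the formulas of consecutive branches agree at the common endpoint. *)
Definition phi lam x : R :=
  if x <= p1 lam then 1 - lam * x
  else if x <= q1 lam then 1 / lam - x
  else if x <= p2 lam then x - (lam - 1) / (2 * lam)
  else if x <= p3 lam then lam * x - (lam - 1) / 2
  else if x <= q2 lam then x + (lam - 1) / (2 * lam)
  else if x <= p4 lam then (2 * lam - 1) / lam - x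
  else lam - lam * x.

(* R^o is R with its usual distance (x, y) |-> `|y - x| *)
Definition F lam (x : R^o) : R^o :=
  if 0 < x then - x
  else phi lam (x - (Num.floor x)%:~R) - (Num.floor x)%:~R - 1.

End the_map.

(* (0, 1) with the distance induced by R *)
Definition open_unit_interval (R : realType) :=
  set_type (`]0, 1[%classic : set R^o).

(* Main.v *)
Require Import Defs.
From HB Require Import structures.
From mathcomp Require Import all_boot all_order all_algebra.
From mathcomp Require Import all_classical all_reals all_analysis.
From mathcomp Require Import ring lra.

Set Implicit Arguments.
Unset Strict Implicit.
Unset Printing Implicit Defensive.

Import Order.TTheory GRing.Theory Num.Theory.
Import numFieldNormedType.Exports.

Local Open Scope classical_set_scope.
Local Open Scope ring_scope.

(** The lift [psi z = F (- z)] of the branch of [F] on the negative half-line is odd and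
    commutes with integer translations; its slopes are lam and 1 in absolute value, its turning
    points are sent to the points m +- a with a = 1/4 - 3/(4 lam), and [F x = - x] for x > 0, so
    that the square of [F] is [psi] on positive reals.

    Mixing: the four points of each period where the slope changes without a turn, and the
    integers, are sent to integers. So an interval whose iterates avoid all integers is stretched
    by lam on a whole piece, or folded once (losing a factor 2) into distance a of an integer,
    where it is only shifted towards the integer until it is stretched by lam > 3. Hence some
    iterate contains an integer, then a unit interval, and then grows linearly on both sides.

    No specification: [F] moves |x| by at most 1, so the transition time between distant points
    is unbounded.

    Specification on (0, 1): transport [F] by x |-> (1 + x / (1 + |x|)) / 2, which makes a
    neighbourhood of each end of the line small. A segment with one end on the orbit of y keeps a
    length >= d/3 when it is cut back to length <= d at each step (same folding argument). While y
    is far out the segment need not be cut, so after a bounded time its image contains a unit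
    interval at a fixed distance M2 from 0, where it can wait for y to come back. Hence all orbit
    pieces are shadowed from a fixed compact set, ending in an interval of fixed length that
    covers the compact set again after a uniform time. *)

(** * The reflected lift and its seven affine pieces *)

Section reflected_lift.
Context (R : realType) (lam : R) (hlam : 3 < lam).
Implicit Types (x y z b c e u : R) (m : int) (n k : nat).

Definition psi z : R := phi lam (- z - (Num.floor (- z))%:~R) - (Num.floor (- z))%:~R - 1.

Local Notation p := (lam^-1).

Lemma F_psi x : F lam x = if 0 < x then - x else psi (- x).
Proof. by rewrite /F /psi opprK. Qed.

Lemma mul_lam_inv : lam * lam^-1 = 1.
Proof. by have h := hlam; rewrite divff// gt_eqF//; lra. Qed.

Lemma lam_inv_gt0 : 0 < lam^-1.
Proof. by have h := hlam; rewrite invr_gt0; lra. Qed.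

Lemma lam_inv_lt : 3 * lam^-1 < 1.
Proof. by have h := hlam; have L := mul_lam_inv; have P := lam_inv_gt0; nra. Qed.

Lemma lam_facts : [/\ 3 < lam, lam * p = 1, 0 < p & 3 * p < 1].
Proof. by split; [exact: hlam|exact: mul_lam_inv|exact: lam_inv_gt0|exact: lam_inv_lt]. Qed.

(** With break points and branches written through [p], arithmetic on them only needs the facts in
    [lam_facts]. *)
Lemma phiE x : phi lam x =
  if x <= p then 1 - lam * x
  else if x <= 4^-1 + p / 4 then p - x
  else if x <= 2^-1 - p / 2 then x - (2^-1 - p / 2)
  else if x <= 2^-1 + p / 2 then 2^-1 - lam * (2^-1 - x)
  else if x <= 3 / 4 - p / 4 then x + (2^-1 - p / 2)
  else if x <= 1 - p then 2 - p - x
  else lam * (1 - x).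
Proof.
have h := hlam; have l0 : lam != 0 by rewrite gt_eqF//; lra.
rewrite /phi /p1 /q1 /p2 /p3 /q2 /p4 div1r.
have -> : (lam + 1) / (4 * lam) = 4^-1 + p / 4 by field.
have -> : (lam - 1) / (2 * lam) = 2^-1 - p / 2 by field.
have -> : (lam + 1) / (2 * lam) = 2^-1 + p / 2 by field.
have -> : (3 * lam - 1) / (4 * lam) = 3 / 4 - p / 4 by field.
have -> : (lam - 1) / lam = 1 - p by field.
have -> : (2 * lam - 1) / lam = 2 - p by field.
by repeat case: ifP => _ //; field.
Qed.

Lemma psiD z m : psi (z + m%:~R) = psi z + m%:~R.
Proof.
have fl : Num.floor (- (z + m%:~R)) = Num.floor (- z) - m.
  by rewrite opprD -(mulrNz 1 m) floorDrz ?intr_int// intrKfloor.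
rewrite /psi fl intrB.
set f := (Num.floor (- z))%:~R : R.
have -> : - (z + m%:~R) - (f - m%:~R) = - z - f by ring.
ring.
Qed.

Lemma psi01 z : 0 <= z <= 1 -> psi z = phi lam (1 - z).
Proof.
have [h L P0 PL] := lam_facts.
move=> /andP[z0 z1]; have [->|zn0] := eqVneq z 0.
  (* At 0 the floor of [- z] is 0 instead of -1; the values 1 and 0 of [phi] at 0 and 1 compensate
     for this. *)
  rewrite /psi oppr0 floor0 !subr0 !phiE ifT; last by lra.
  by do 6 ![rewrite ifF; last lra]; lra.
have zgt : 0 < z by rewrite lt_neqAle eq_sym zn0.
rewrite /psi (_ : Num.floor (- z) = -1); last first.
  by apply: floor_def; rewrite addNr; lra.
by rewrite mulrN1z opprK addrK addrC.
Qed.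

(** The suffixes a to g number the pieces of [psi] on [0, 1] from left to right; up to sign, the
    slope is [lam] on a, d, g and 1 on the others. *)
Lemma psi_a z : 0 <= z <= p -> psi z = lam * z.
Proof.
have [h L P0 PL] := lam_facts; move=> /andP[z0 z1]; rewrite psi01 ?phiE; last lra.
by repeat (case: ifP => ?; first by [lra|nra]); nra.
Qed.

Lemma psi_b z : p <= z <= 4^-1 + p / 4 -> psi z = 1 - p + z.
Proof.
have [h L P0 PL] := lam_facts; move=> /andP[z0 z1]; rewrite psi01 ?phiE; last lra.
by repeat (case: ifP => ?; first by [lra|nra]); nra.
Qed.

Lemma psi_c z : 4^-1 + p / 4 <= z <= 2^-1 - p / 2 -> psi z = 3 / 2 - p / 2 - z.
Proof.
have [h L P0 PL] := lam_facts; move=> /andP[z0 z1]; rewrite psi01 ?phiE; last lra.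
by repeat (case: ifP => ?; first by [lra|nra]); nra.
Qed.

Lemma psi_d z : 2^-1 - p / 2 <= z <= 2^-1 + p / 2 -> psi z = 2^-1 - lam * (z - 2^-1).
Proof.
have [h L P0 PL] := lam_facts; move=> /andP[z0 z1]; rewrite psi01 ?phiE; last lra.
by repeat (case: ifP => ?; first by [lra|nra]); nra.
Qed.

Lemma psi_e z : 2^-1 + p / 2 <= z <= 3 / 4 - p / 4 -> psi z = 2^-1 + p / 2 - z.
Proof.
have [h L P0 PL] := lam_facts; move=> /andP[z0 z1]; rewrite psi01 ?phiE; last lra.
by repeat (case: ifP => ?; first by [lra|nra]); nra.
Qed.

Lemma psi_f z : 3 / 4 - p / 4 <= z <= 1 - p -> psi z = z - 1 + p.
Proof.
have [h L P0 PL] := lam_facts; move=> /andP[z0 z1]; rewrite psi01 ?phiE; last lra.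
by repeat (case: ifP => ?; first by [lra|nra]); nra.
Qed.

Lemma psi_g z : 1 - p <= z <= 1 -> psi z = 1 - lam * (1 - z).
Proof.
have [h L P0 PL] := lam_facts; move=> /andP[z0 z1]; rewrite psi01 ?phiE; last lra.
by repeat (case: ifP => ?; first by [lra|nra]); nra.
Qed.

End reflected_lift.

(** * Symmetry, displacement and laps of the lift *)

Section lift_geometry.
Context (R : realType) (lam : R) (hlam : 3 < lam).
Implicit Types (x y z u w b c : R) (m : int) (n : nat).
Local Notation p := (lam^-1).
Local Notation psi := (psi lam).

Lemma floor_decomp z : exists (m : int) u, z = u + m%:~R /\ 0 <= u < 1.
Proof.
exists (Num.floor z), (z - (Num.floor z)%:~R); split; first by rewrite subrK.
have /andP[] := floor_itv z; rewrite intrD; set f := _%:~R => *; lra.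
Qed.

Ltac split7 z :=
  case: (leP z p) => ?; [|
  case: (leP z (4^-1 + p / 4)) => ?; [|
  case: (leP z (2^-1 - p / 2)) => ?; [|
  case: (leP z (2^-1 + p / 2)) => ?; [|
  case: (leP z (3 / 4 - p / 4)) => ?; [|
  case: (leP z (1 - p)) => ?; [|]]]]]].

Lemma psi01_range u : 0 <= u <= 1 ->
  3 / 4 * p - 4^-1 <= psi u <= 5 / 4 - 3 / 4 * p /\ `|psi u - u| <= 1.
Proof.
have [h L P0 PL] := lam_facts hlam; move=> /andP[u0 u1].
split7 u; [rewrite (psi_a hlam)|rewrite (psi_b hlam)|rewrite (psi_c hlam)|rewrite (psi_d hlam)
 |rewrite (psi_e hlam)|rewrite (psi_f hlam)|rewrite (psi_g hlam)]; try lra;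
 split; rewrite ?ler_norml; nra.
Qed.

(** Modulo integer translations this is the symmetry of the graph over [0, 1] about (1/2, 1/2),
    which exchanges pieces a and g, b and f, c and e, and preserves d. *)
Lemma psiN z : psi (- z) = - psi z.
Proof.
have [h L P0 PL] := lam_facts hlam.
have [m [u [-> /andP[u0 u1]]]] := floor_decomp z.
have -> : - (u + m%:~R) = (1 - u) + (- m - 1)%:~R :> R by rewrite intrB mulrNz; ring.
rewrite !psiD intrB mulrNz.
suff -> : psi (1 - u) = 1 - psi u by ring.
split7 u; [rewrite (@psi_a _ _ hlam u) ?(psi_g hlam)|
  rewrite (@psi_b _ _ hlam u) ?(psi_f hlam)|
  rewrite (@psi_c _ _ hlam u) ?(psi_e hlam)|
  rewrite !(psi_d hlam)|
  rewrite (@psi_e _ _ hlam u) ?(psi_c hlam)|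
  rewrite (@psi_f _ _ hlam u) ?(psi_b hlam)|
  rewrite (@psi_g _ _ hlam u) ?(psi_a hlam)]; lra.
Qed.

Lemma psi_int m : psi m%:~R = m%:~R.
Proof.
have [h L P0 PL] := lam_facts hlam.
rewrite -[X in psi X]add0r psiD (psi_a hlam) ?mulr0 ?add0r//; lra.
Qed.

Lemma psi_dist z : `|psi z - z| <= 1.
Proof.
have [m [u [-> u01]]] := floor_decomp z; rewrite psiD opprD addrACA subrr addr0.
by apply: (psi01_range _).2; lra.
Qed.

(* The laps of psi end at the points m + q1 and m + 1 - q1, q1 = 1/4 + p/4. *)
Lemma lap_increasing m x y : x <= y ->
  m%:~R - (4^-1 + p / 4) <= x -> y <= m%:~R + (4^-1 + p / 4) ->
  y - x <= psi y - psi x.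
Proof.
have [h L P0 PL] := lam_facts hlam.
rewrite -[x](subrK m%:~R) -[y](subrK m%:~R) !psiD.
move: (x - _) (y - _) => {}x {}y xy xm my.
have {}xm : - (4^-1 + p / 4) <= x by lra.
have {}my : y <= 4^-1 + p / 4 by lra.
have pos a b : 0 <= a -> a <= b -> b <= 4^-1 + p / 4 -> b - a <= psi b - psi a.
  move=> a0 ab b1; case: (leP a p) => ?; case: (leP b p) => ?.
  - by rewrite !(psi_a hlam); nra.
  - by rewrite (psi_a hlam (z := a)) ?(psi_b hlam); nra.
  - by lra.
  - by rewrite !(psi_b hlam); lra.
have neg a b : a <= b -> b <= 0 -> - (4^-1 + p / 4) <= a -> b - a <= psi b - psi a.
  move=> ab b0 a1; have := pos (- b) (- a); rewrite !psiN; lra.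
case: (leP 0 x) => x0; first by have := pos x y; lra.
case: (leP 0 y) => y0; last by have := neg x y; lra.
have := pos 0 y; have := neg x 0; rewrite -(mulr0z 1) psi_int; lra.
Qed.

Lemma lap_decreasing m x y : x <= y ->
  m%:~R + (4^-1 + p / 4) <= x -> y <= m%:~R + (3 / 4 - p / 4) ->
  y - x <= psi x - psi y.
Proof.
have [h L P0 PL] := lam_facts hlam.
rewrite -[x](subrK m%:~R) -[y](subrK m%:~R) !psiD.
move: (x - _) (y - _) => {}x {}y xy xm my.
have {}xm : 4^-1 + p / 4 <= x by lra.
have {}my : y <= 3 / 4 - p / 4 by lra.
case: (leP x (2^-1 - p / 2)) => ?; [rewrite (psi_c hlam (z := x)); last lra|
  case: (leP x (2^-1 + p / 2)) => ?; [rewrite (psi_d hlam (z := x)); last lra|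
  rewrite (psi_e hlam (z := x)); last lra]];
(case: (leP y (2^-1 - p / 2)) => ?; [rewrite (psi_c hlam (z := y)); last lra|
  case: (leP y (2^-1 + p / 2)) => ?; [rewrite (psi_d hlam (z := y)); last lra|
  rewrite (psi_e hlam (z := y)); last lra]]); nra.
Qed.

End lift_geometry.

(** * Gluing Lipschitz estimates; intermediate values *)

Section continuity.
Context (R : realType).
Implicit Types (f g : R -> R) (a b c d x y v k : R).

Definition lipschitz_between k f a b :=
  forall x y, a <= x -> x <= y -> y <= b -> `|f y - f x| <= k * (y - x).

Lemma lipschitz_between_cat k f a b c :
  lipschitz_between k f a b -> lipschitz_between k f b c -> lipschitz_between k f a c.
Proof.
move=> fab fbc x y ax xy yc.
case: (leP y b) => yb; first exact: fab.
case: (leP b x) => bx; first exact: fbc.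
have -> : f y - f x = (f y - f b) + (f b - f x) by rewrite addrA subrK.
rewrite (le_trans (ler_normD _ _))//.
have -> : k * (y - x) = k * (y - b) + k * (b - x) by ring.
by apply: lerD; [apply: fbc|apply: fab]; lra.
Qed.

Lemma lipschitz_continuous k f : 0 < k ->
  (forall n : nat, lipschitz_between k f (- n%:R) n%:R) -> continuous f.
Proof.
move=> k0 fL x; apply/cvgrPdist_lt => e e0.
have := archi_boundP (addr_ge0 (normr_ge0 x) (@ler01 R)).
set n := Num.bound _ => xn.
have ek : 0 < e / k by rewrite divr_gt0.
near=> y.
have xy1 : `|x - y| < 1 by near: y; exact: cvgr_dist_lt.
have xye : `|x - y| < e / k by near: y; exact: cvgr_dist_lt.
have H : k * `|x - y| < e by rewrite mulrC -ltr_pdivlMr.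
apply: le_lt_trans H; move: xy1 xn; rewrite ltr_norml => /andP[xy1 yx1] xn.
have /andP[x1 x2] : - n%:R + 1 <= x <= n%:R - 1.
  by move: (ler_norm x) (ler_norm (- x)); rewrite normrN; lra.
have [xy|yx] := leP x y; [rewrite distrC (@ler0_norm _ (x - y)) ?opprB|
  rewrite (@ger0_norm _ (x - y))]; try lra; by apply: (fL n); lra.
Unshelve. all: by end_near.
Qed.

Lemma ivt f b c x y v : continuous f -> b <= x <= c -> b <= y <= c ->
  f x <= v <= f y -> exists z, b <= z <= c /\ f z = v.
Proof.
move=> cf bxc byc fv.
have cw s t : {within `[s, t], continuous f} by apply: continuous_subspaceT.
have [xy|yx] := leP x y.
  have [|z] := @IVT _ f x y v xy (cw _ _).
    by rewrite ge_min le_max; case/andP: fv => -> ->; rewrite orbT.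
  by rewrite in_itv/= => zi fz; exists z; split=> //; lra.
have [|z] := @IVT _ f y x v (ltW yx) (cw _ _).
  by rewrite ge_min le_max; case/andP: fv => -> ->; rewrite orbT.
by rewrite in_itv/= => zi fz; exists z; split=> //; lra.
Qed.

Lemma iter_continuous f n : continuous f -> continuous (iter n f).
Proof.
move=> cf; elim: n => [|n IH] x /=; first exact: cvg_id.
by apply: (@continuous_comp _ _ _ (iter n f) f); [exact: IH|exact: cf].
Qed.

End continuity.

(** * Continuity of [psi] and [F] *)

Section lift_continuity.
Context (R : realType) (lam : R) (hlam : 3 < lam).
Implicit Types (x y z u w b c : R) (m : int) (n : nat).
Local Notation p := (lam^-1).
Local Notation psi := (psi lam).
Local Notation F := (F lam : R -> R).

Lemma psi_lipschitz01 : lipschitz_between lam psi 0 1.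
Proof.
have [h L P0 PL] := lam_facts hlam.
apply: (@lipschitz_between_cat _ _ _ _ p).
  by move=> x y *; rewrite !(psi_a hlam) ?ler_norml; nra.
apply: (@lipschitz_between_cat _ _ _ _ (4^-1 + p / 4)).
  by move=> x y *; rewrite !(psi_b hlam) ?ler_norml; nra.
apply: (@lipschitz_between_cat _ _ _ _ (2^-1 - p / 2)).
  by move=> x y *; rewrite !(psi_c hlam) ?ler_norml; nra.
apply: (@lipschitz_between_cat _ _ _ _ (2^-1 + p / 2)).
  by move=> x y *; rewrite !(psi_d hlam) ?ler_norml; nra.
apply: (@lipschitz_between_cat _ _ _ _ (3 / 4 - p / 4)).
  by move=> x y *; rewrite !(psi_e hlam) ?ler_norml; nra.
apply: (@lipschitz_between_cat _ _ _ _ (1 - p)).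
  by move=> x y *; rewrite !(psi_f hlam) ?ler_norml; nra.
by move=> x y *; rewrite !(psi_g hlam) ?ler_norml; nra.
Qed.

Lemma psi_lipschitz n : lipschitz_between lam psi 0 n%:R.
Proof.
elim: n => [|n IH].
  by move=> x y x0 xy y0; have -> : y = x by [lra]; rewrite !subrr mulr0 normr0.
apply: (lipschitz_between_cat IH) => x y nx xy yn.
rewrite -[x](subrK n%:~R) -[y](subrK n%:~R) !psiD opprD addrACA subrr addr0.
rewrite -addn1 natrD in yn.
by rewrite [leRHS](_ : _ = lam * (y - n%:~R - (x - n%:~R)));
  [apply: psi_lipschitz01; rewrite ?pmulrn in nx yn *; lra|ring].
Qed.

Lemma F_lipschitz n : lipschitz_between lam F (- n%:R) n%:R.
Proof.
have h := hlam.
apply: (@lipschitz_between_cat _ _ _ _ 0) => x y nx xy yn.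
  rewrite !F_psi !ifF; try lra.
  rewrite distrC [leRHS](_ : _ = lam * (- x - - y)); last by ring.
  by apply: (@psi_lipschitz n); lra.
have Fn z : 0 <= z -> F z = - z.
  move=> z0; rewrite F_psi; case: ifP => // zn.
  by have -> : z = 0 by [lra]; rewrite oppr0 -(mulr0z 1) psi_int.
by rewrite !Fn ?(le_trans nx)// -opprD normrN ger0_norm; nra.
Qed.

Lemma F_continuous : continuous (F : R -> R).
Proof. by have h := hlam; apply: (@lipschitz_continuous _ lam); [lra|exact: F_lipschitz]. Qed.

Lemma psi_continuous : continuous psi.
Proof.
have h := hlam; apply: (@lipschitz_continuous _ lam); first lra.
move=> n; apply: (@lipschitz_between_cat _ _ _ _ 0); last exact: psi_lipschitz.
move=> x y nx xy y0; have := @psi_lipschitz n (- y) (- x).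
by rewrite !(psiN hlam) !opprK [X in `|X|]addrC [y - x]addrC; apply; lra.
Qed.

Lemma F_nonneg x : 0 <= x -> F x = - x.
Proof.
rewrite F_psi; case: ifP => // zn x0.
by have -> : x = 0 by [lra]; rewrite oppr0 -(mulr0z 1) psi_int.
Qed.

Lemma F_nonpos x : x <= 0 -> F x = psi (- x).
Proof. by move=> x0; rewrite F_psi ifF//; lra. Qed.

End lift_continuity.

(** * Covering relations between intervals *)

Section covering.
Context (R : realType) (f : R -> R).
Implicit Types (b c : R) (n : nat).

(** Only a lower bound on the image is recorded, so relations compose without computing images; the
    relation is vacuous when [c' < b']. *)
Definition covers n b c b' c' :=
  forall v, b' <= v <= c' -> exists x, b <= x <= c /\ iter n f x = v.

Lemma covers_refl b c : covers 0 b c b c.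
Proof. by move=> v bvc; exists v. Qed.

Lemma covers_trans n n' b c b' c' b'' c'' :
  covers n b c b' c' -> covers n' b' c' b'' c'' -> covers (n' + n) b c b'' c''.
Proof.
move=> h h' v /h'[x [/h[w [wbc <-]] <-]].
by exists w; rewrite iterD.
Qed.

Lemma covers_sub n b c b' c' b1 c1 b2 c2 : covers n b1 c1 b2 c2 ->
  b <= b1 -> c1 <= c -> b2 <= b' -> c' <= c2 -> covers n b c b' c'.
Proof.
move=> h ? ? ? ? v vbc; have [|x [xbc <-]] := h v; first lra.
by exists x; split=> //; lra.
Qed.

Lemma ivt_covers n b c x y : continuous f -> b <= x <= c -> b <= y <= c ->
  covers n b c (iter n f x) (iter n f y).
Proof.
by move=> cf bxc byc v vb; apply: ivt bxc byc vb; exact: iter_continuous.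
Qed.

(* Compactness: an interval of length e contains one of finitely many intervals of length e/2. *)
Lemma eventually_uniform (P : R -> R -> nat -> Prop) lo hi e : 0 < e ->
  (forall b c b' c' n, b' <= b -> c <= c' -> P b c n -> P b' c' n) ->
  (forall b c, b < c -> exists N, forall n, (N <= n)%N -> P b c n) ->
  exists N, forall b n, lo <= b <= hi -> (N <= n)%N -> P b (b + e) n.
Proof.
move=> e0 Pmono Pev.
have key k : exists N, forall b n, lo <= b <= lo + k%:R * (e / 2) -> (N <= n)%N -> P b (b + e) n.
  elim: k => [|k [N HN]].
    have [|N HN] := Pev lo (lo + e); first lra.
    by exists N => b n; rewrite mul0r addr0 => lob Nn; apply: (Pmono _ _ _ _ _ _ _ (HN n Nn)); lra.
  have [|N' HN'] := Pev (lo + k%:R * (e / 2) + e / 2) (lo + k%:R * (e / 2) + e); first lra.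
  exists (maxn N N') => b n; rewrite -natr1 geq_max => lob /andP[Nn Nn'].
  have [lek|gtk] := leP b (lo + k%:R * (e / 2)); first by apply: HN => //; lra.
  by apply: (Pmono _ _ _ _ _ _ _ (HN' n Nn')); lra.
have e2 : 0 < e / 2 by lra.
have [N HN] := key (Num.bound (`|hi - lo| / (e / 2))).
exists N => b n lob; apply: HN.
have : `|hi - lo| / (e / 2) < (Num.bound (`|hi - lo| / (e / 2)))%:R.
  by apply: archi_boundP; rewrite divr_ge0// ltW.
rewrite ltr_pdivrMr//; move: (ler_norm (hi - lo)); lra.
Qed.

End covering.

(** * Growth of short intervals under the lift *)

Section lift_growth.
Context (R : realType) (lam : R) (hlam : 3 < lam).
Implicit Types (x y z u w b c e : R) (m : int) (n k : nat).
Local Notation p := (lam^-1).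
Local Notation psi := (psi lam).
Local Notation covers := (covers psi).

Lemma iter_psiD n z m : iter n psi (z + m%:~R) = iter n psi z + m%:~R.
Proof. by elim: n => //= n ->; rewrite psiD. Qed.

Lemma iter_psiN n z : iter n psi (- z) = - iter n psi z.
Proof. by elim: n => //= n ->; rewrite (psiN hlam). Qed.

Lemma covers_psiD n b c b' c' m : covers n b c b' c' ->
  covers n (b + m%:~R) (c + m%:~R) (b' + m%:~R) (c' + m%:~R).
Proof.
move=> h v vb; have [|x [xb xv]] := h (v - m%:~R); first lra.
by exists (x + m%:~R); rewrite iter_psiD xv subrK; split=> //; lra.
Qed.

Lemma covers_psiN n b c b' c' : covers n b c b' c' -> covers n (- c) (- b) (- c') (- b').
Proof.
move=> h v vb; have [|x [xb xv]] := h (- v); first lra.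
by exists (- x); rewrite iter_psiN xv opprK; split=> //; lra.
Qed.

Lemma psi_covers b c x y : b <= x <= c -> b <= y <= c -> covers 1 b c (psi x) (psi y).
Proof. by move=> bx /(ivt_covers (n := 1) (psi_continuous hlam) bx). Qed.

(** The dichotomy behind mixing: either a definite gain in length, or an integer is reached, from
    where growth is unconditional. *)
Definition grows (k : R) b c := exists n b' c', [/\ covers n b c b' c', b' < c' &
  (k * (c - b) <= c' - b' \/ exists m : int, b' < m%:~R < c')].

Lemma growsD (k : R) b c m : grows k (b - m%:~R) (c - m%:~R) -> grows k b c.
Proof.
move=> [n [b' [c' [/(@covers_psiD _ _ _ _ _ m) h bc' H]]]].
exists n, (b' + m%:~R), (c' + m%:~R); split; [|lra|].
  by rewrite !subrK in h.
case: H => [H|[m' H]]; [left; lra|right; exists (m' + m)].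
rewrite intrD; lra.
Qed.

Lemma growsN (k : R) b c : grows k (- c) (- b) -> grows k b c.
Proof.
move=> [n [b' [c' [/covers_psiN h bc' H]]]].
exists n, (- c'), (- b'); split; [|lra|].
  by rewrite !opprK in h.
by case: H => [H|[m' H]]; [left; lra|right; exists (- m'); rewrite mulrNz; lra].
Qed.

Lemma grows_step (k k' : R) b c b' c' : 0 < k' -> covers 1 b c b' c' ->
  k * (c - b) <= k' * (c' - b') -> grows k' b' c' -> grows k b c.
Proof.
move=> k0 h1 le [n [b2 [c2 [h2 bc2 H]]]].
exists (n + 1)%N, b2, c2; split => //; first exact: covers_trans h1 h2.
by case: H => H; [left; lra|right].
Qed.

Lemma grows_int (k : R) b c x y m : b <= x <= c -> b <= y <= c ->
  psi x < m%:~R < psi y -> grows k b c.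
Proof.
move=> bx by_ h; exists 1%N, (psi x), (psi y); split; first exact: psi_covers.
  lra.
by right; exists m.
Qed.

(** Modulo 1, piece b moves points left by [p], so each step there lowers [k] by one. Inside [0, p]
    the interval is stretched by [lam]; if it straddles [p], its image straddles [psi p = 1]. *)
Lemma grows_near_int_upto k b c : 0 <= b -> b < c -> c <= 4^-1 - 3 / 4 * p -> c <= k%:R * p ->
  grows lam b c.
Proof.
have [h L P0 PL] := lam_facts hlam.
elim: k b c => [|k IH] b c b0 bc ca ckp; first lra.
rewrite -natr1 in ckp.
have [cp|pc] := leP c p.
  exists 1%N, (psi b), (psi c); split; first by apply: psi_covers; lra.
    by rewrite !(psi_a hlam); nra.
  by left; rewrite !(psi_a hlam); nra.
have [pb|bp] := leP p b.
  apply: (@grows_step _ lam _ _ (psi b) (psi c)); first lra.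
  - by apply: psi_covers; lra.
  - by rewrite !(psi_b hlam); lra.
  apply: (@growsD _ _ _ 1); rewrite !(psi_b hlam); try lra.
  by apply: IH; lra.
apply: (@grows_int _ b c b c 1); try lra.
by rewrite (psi_a hlam) ?(psi_b hlam); nra.
Qed.

Lemma grows_near_int b c : 0 <= b -> b < c -> c <= 4^-1 - 3 / 4 * p -> grows lam b c.
Proof.
have [h L P0 PL] := lam_facts hlam; move=> b0 bc ca.
apply: (@grows_near_int_upto (Num.bound lam)) => //.
have : lam < (Num.bound lam)%:R by apply: archi_boundP; lra.
nra.
Qed.

(** Both break points have the value 1 and [psi] is strictly monotone across each of them, so values
    on both sides of 1 occur. *)
Lemma grows_break (k : R) b c : 0 <= b -> c <= 1 ->
  (b < p < c \/ b < 2^-1 - p / 2 < c) -> grows k b c.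
Proof.
have [h L P0 PL] := lam_facts hlam; move=> b0 c1 [bpc|bpc].
  have [cq|qc] := leP c (4^-1 + p / 4).
    apply: (@grows_int _ b c b c 1); try lra.
    by rewrite (psi_a hlam) ?(psi_b hlam (z := c)); nra.
  apply: (@grows_int _ b c b (4^-1 + p / 4) 1); try lra.
  by rewrite (psi_a hlam) ?(psi_b hlam); nra.
have up : exists2 x, b <= x <= c & 1 < psi x.
  have [qb|bq] := leP (4^-1 + p / 4) b.
    by exists b; rewrite ?(psi_c hlam); lra.
  by exists (4^-1 + p / 4); rewrite ?(psi_c hlam); lra.
have down : exists2 x, b <= x <= c & psi x < 1.
  have [cp|pc] := leP c (2^-1 + p / 2).
    by exists c; rewrite ?(psi_d hlam); nra.
  by exists (2^-1 + p / 2); rewrite ?(psi_d hlam); nra.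
case: up down => x xb x1 [y yb y1].
by apply: (@grows_int _ b c y x 1) => //; rewrite y1.
Qed.

(** The longer side of the turning point keeps at least half of the length. Its image lies in
    [1, 5/4 - 3p/4], where [grows_near_int] supplies the full factor [lam]. *)
Lemma grows_fold b c : p <= b -> b < c -> c <= 2^-1 - p / 2 -> grows (lam / 2) b c.
Proof.
have [h L P0 PL] := lam_facts hlam; move=> pb bc cp.
have left b1 c1 : p <= b1 -> b1 < c1 -> c1 <= 4^-1 + p / 4 ->
    b <= b1 -> c1 <= c -> c - b <= 2 * (c1 - b1) -> grows (lam / 2) b c.
  move=> *; apply: (@grows_step _ lam _ _ (psi b1) (psi c1)); first lra.
  - by apply: psi_covers; lra.
  - by rewrite !(psi_b hlam); nra.
  apply: (@growsD _ _ _ 1); rewrite !(psi_b hlam); try lra.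
  by apply: grows_near_int; lra.
have right b1 c1 : 4^-1 + p / 4 <= b1 -> b1 < c1 -> c1 <= 2^-1 - p / 2 ->
    b <= b1 -> c1 <= c -> c - b <= 2 * (c1 - b1) -> grows (lam / 2) b c.
  move=> *; apply: (@grows_step _ lam _ _ (psi c1) (psi b1)); first lra.
  - by apply: psi_covers; lra.
  - by rewrite !(psi_c hlam); nra.
  apply: (@growsD _ _ _ 1); rewrite !(psi_c hlam); try lra.
  by apply: grows_near_int; lra.
have [cq|qc] := leP c (4^-1 + p / 4); first by apply: (left b c); lra.
have [qb|bq] := leP (4^-1 + p / 4) b; first by apply: (right b c); lra.
have [?|?] := leP (c - (4^-1 + p / 4)) ((4^-1 + p / 4) - b).
  by apply: (left b (4^-1 + p / 4)); lra.
by apply: (right (4^-1 + p / 4) c); lra.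
Qed.

Lemma grows_left b c : 0 <= b -> b < c -> c <= 2^-1 + p / 2 -> grows (lam / 2) b c.
Proof.
have [h L P0 PL] := lam_facts hlam; move=> b0 bc cp.
have [cp1|p1c] := leP c p.
  exists 1%N, (psi b), (psi c); split; first by apply: psi_covers; lra.
    by rewrite !(psi_a hlam); nra.
  by left; rewrite !(psi_a hlam); nra.
have [p1b|bp1] := leP p b; last by apply: grows_break; [lra|lra|left; lra].
have [cp2|p2c] := leP c (2^-1 - p / 2); first exact: grows_fold.
have [p2b|bp2] := leP (2^-1 - p / 2) b; last by apply: grows_break; [lra|lra|right; lra].
exists 1%N, (psi c), (psi b); split; first by apply: psi_covers; lra.
  by rewrite !(psi_d hlam); nra.
by left; rewrite !(psi_d hlam); nra.
Qed.

Lemma grows_unit b c : 0 <= b -> b < c -> c <= 1 -> grows (lam / 2) b c.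
Proof.
have [h L P0 PL] := lam_facts hlam; move=> b0 bc c1.
have [cp|pc] := leP c (2^-1 + p / 2); first by apply: grows_left; lra.
(* The reflection z -> 1 - z brings the interval to the left half, or puts the break point 1/2 - p/2
   in its interior. *)
apply: growsN; apply: (@growsD _ _ _ (-1)); rewrite mulrN1z opprK.
have [pb|bp] := leP (2^-1 + p / 2) b; first by apply: grows_left; lra.
by apply: grows_break; [lra|lra|right; lra].
Qed.

Lemma grows_cell b c m : m%:~R <= b -> b < c -> c <= m%:~R + 1 -> grows (lam / 2) b c.
Proof. by move=> mb bc cm; apply: (@growsD _ _ _ m); apply: grows_unit; lra. Qed.

End lift_growth.

Lemma succ_le_exp (R : realDomainType) (x : R) (k : nat) : 2 <= x -> k%:R + 1 <= x ^+ k.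
Proof.
move=> x2; elim: k => [|k IH]; first by rewrite add0r expr0.
by rewrite exprS -natr1; have := ler0n R k; nra.
Qed.

(** * From short intervals to arbitrarily long ones under the lift *)

Section lift_expansion.
Context (R : realType) (lam : R) (hlam : 3 < lam).
Implicit Types (x y z u w b c e : R) (m : int) (n k : nat).
Local Notation p := (lam^-1).
Local Notation psi := (psi lam).
Local Notation covers := (covers psi).

(** While no integer is met, [grows_cell] multiplies the length by [lam / 2 > 3 / 2]; this must
    stop, since a length above 1 forces an integer inside. *)
Lemma covers_int b c : b < c ->
  exists n (m : int) e, 0 < e /\ covers n b c (m%:~R - e) (m%:~R + e).
Proof.
have [h L P0 PL] := lam_facts hlam; move=> bc.
have inside b' c' m : b' < m%:~R < c' ->
    exists e, 0 < e /\ covers 0 b' c' (m%:~R - e) (m%:~R + e).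
  move=> bmc; have [?|?] := leP (m%:~R - b') (c' - m%:~R).
    by exists (m%:~R - b'); split; [lra|apply: (covers_sub (@covers_refl _ psi b' c')); lra].
  by exists (c' - m%:~R); split; [lra|apply: (covers_sub (@covers_refl _ psi b' c')); lra].
have key k : forall b c, b < c -> 1 < (3 / 2) ^+ k * (c - b) ->
    exists n (m : int) e, 0 < e /\ covers n b c (m%:~R - e) (m%:~R + e).
  elim: k => [|k IH] {bc}b {}c bc big.
    rewrite expr0 mul1r in big.
    (* This is the largest integer strictly below [c]; it exceeds [b] because [c - b > 1]. *)
    have [|e he] := inside b c (- Num.floor (- c) - 1).
      have := floor_itv (- c); rewrite intrB mulrNz intrD; lra.
    by exists 0%N, (- Num.floor (- c) - 1), e.
  have := floor_itv b; rewrite intrD => fb.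
  have [cm|mc] := leP c ((Num.floor b)%:~R + 1); last first.
    have [|e he] := inside b c (Num.floor b + 1); first by rewrite intrD; lra.
    by exists 0%N, (Num.floor b + 1), e.
  have [|||n [b' [c' [h1 bc' H]]]] := @grows_cell _ _ hlam b c (Num.floor b); [lra|exact: bc|lra|].
  case: H => [H|[m /inside[e [e0 he]]]]; last first.
    by exists (0 + n)%N, m, e; split=> //; apply: covers_trans h1 he.
  have [||n' [m [e [e0 he]]]] := IH b' c'; [exact: bc'| |].
    apply: (lt_le_trans big); rewrite exprSr -mulrA ler_pM2l ?exprn_gt0; nra.
  by exists (n' + n)%N, m, e; split=> //; apply: covers_trans h1 he.
have := archi_boundP (divr_ge0 ler01 (ltW (_ : 0 < c - b))).
have cb : 0 < c - b by lra.
move=> /(_ cb); set k := Num.bound _; rewrite ltr_pdivrMr// => kb.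
(* The exponent is doubled because [succ_le_exp] asks for a base at least 2, and (3/2)^2 is one. *)
apply: (key k.*2) => //; apply: (lt_le_trans kb); rewrite ler_pM2r//.
rewrite -mul2n exprM.
have : k%:R + 1 <= ((3 / 2) ^+ 2) ^+ k :> R by apply: succ_le_exp; lra.
lra.
Qed.

(** An integer is a fixed point with slope [lam] on both sides up to distance [p]; radii grow by
    [lam] until they reach [p], and one more step gives radius 1. *)
Lemma covers_around_int m e : 0 < e ->
  exists n, covers n (m%:~R - e) (m%:~R + e) (m%:~R - 1) (m%:~R + 1).
Proof.
have [h L P0 PL] := lam_facts hlam.
have step e' : 0 < e' -> e' <= p ->
    covers 1 (m%:~R - e') (m%:~R + e') (m%:~R - lam * e') (m%:~R + lam * e').
  move=> e0 ep; have := @psi_covers _ _ hlam (m%:~R - e') (m%:~R + e') (- e' + m%:~R) (e' + m%:~R).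
  rewrite !psiD (psiN hlam) (psi_a hlam); last lra.
  by rewrite !(addrC _ m%:~R); apply; lra.
have key k : forall e, 0 < e -> p <= 3 ^+ k * e ->
    exists n, covers n (m%:~R - e) (m%:~R + e) (m%:~R - 1) (m%:~R + 1).
  elim: k => [|k IH] {}e e0; last first.
    have [pe _|ep pk] := leP p e.
      by exists 1%N; apply: (covers_sub (step p _ _)); lra.
    have [||n hn] := IH (lam * e); first by nra.
      rewrite (le_trans pk)// exprSr -mulrA ler_pM2l ?exprn_gt0; nra.
    by exists (n + 1)%N; apply: covers_trans hn; apply: step; lra.
  rewrite expr0 mul1r => pe.
  by exists 1%N; apply: (covers_sub (step p _ _)); lra.
move=> e0; have := archi_boundP (divr_ge0 (ltW P0) (ltW e0)).
set k := Num.bound _; rewrite ltr_pdivrMr// => kb.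
apply: (key k) => //; apply: (le_trans (ltW kb)); rewrite ler_pM2r//.
have : k%:R + 1 <= 3 ^+ k :> R by apply: succ_le_exp; lra.
lra.
Qed.

Local Notation kap := (8^-1 - 3 / 8 * p).

Lemma kap_gt0 : 0 < kap.
Proof. by have [h L P0 PL] := lam_facts hlam; lra. Qed.

(** [kap] is half of 1/4 - 3p/4, the height of the maxima of [psi] above an integer. If the
    fractional part [r] is at most [kap], the maximum in the previous cell is far enough ahead;
    otherwise [c] itself or the maximum in its own cell is. *)
Lemma push_right c : exists z, c - 1 <= z <= c /\ c + kap <= psi z.
Proof.
have [h L P0 PL] := lam_facts hlam.
have [m [r [-> r01]]] := floor_decomp c.
have qE : psi (4^-1 + p / 4) = 5 / 4 - 3 / 4 * p by rewrite (psi_b hlam); lra.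
have [r1|r1] := leP r kap.
  by exists (4^-1 + p / 4 + (m - 1)%:~R); rewrite psiD qE intrB; lra.
have [r2|r2] := leP r p; first by exists (r + m%:~R); rewrite psiD (psi_a hlam); nra.
have [r3|r3] := leP r (4^-1 + p / 4); first by exists (r + m%:~R); rewrite psiD (psi_b hlam); lra.
by exists (4^-1 + p / 4 + m%:~R); rewrite psiD qE; lra.
Qed.

Lemma push_left b : exists z, b <= z <= b + 1 /\ psi z <= b - kap.
Proof.
have [z [z1 z2]] := push_right (- b).
by exists (- z); rewrite (psiN hlam); lra.
Qed.

Lemma covers_outward n b c : 1 <= c - b ->
  covers n b c (b - n%:R * kap) (c + n%:R * kap).
Proof.
have k0 := kap_gt0; move=> bc; elim: n => [|n IH].
  by rewrite !mul0r subr0 addr0; exact: covers_refl.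
have n0 : 0 <= n%:R * kap by rewrite mulr_ge0// ltW.
set b' := b - _ in IH; set c' := c + _ in IH.
have [x [xb xp]] := push_left b'; have [y [yb yp]] := push_right c'.
apply: (@covers_trans _ _ n 1%N _ _ b' c') => //.
have := @psi_covers _ _ hlam b' c' x y; rewrite -[n.+1%:R]natr1 /b' /c' in xb yb xp yp *.
by move=> H; apply: (covers_sub (H _ _)); lra.
Qed.

Lemma psi_growth b c A : b < c ->
  exists N, forall n, (N <= n)%N -> covers n b c (- A) A.
Proof.
have k0 := kap_gt0; move=> bc.
have [n0 [m [e [e0 h1]]]] := covers_int bc.
have [n1 h2] := covers_around_int m e0.
have := archi_boundP (divr_ge0 (addr_ge0 (normr_ge0 A) (normr_ge0 (m%:~R : R))) (ltW k0)).
set k := Num.bound _; rewrite ltr_pdivrMr// => kb.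
exists (k + (n1 + n0))%N => n /subnK <-; rewrite addnA.
set j := (n - _)%N.
have := covers_trans (covers_trans h1 h2) (@covers_outward (j + k) _ _ _).
move=> H; apply: (covers_sub (H _)) => //; try lra.
  have : k%:R * kap <= (j + k)%:R * kap by rewrite ler_pM2r// ler_nat leq_addl.
  move: (ler_norm A) (ler_norm (m%:~R : R)); lra.
have : k%:R * kap <= (j + k)%:R * kap by rewrite ler_pM2r// ler_nat leq_addl.
move: (ler_norm A) (ler_norm (- m%:~R : R)); rewrite normrN; lra.
Qed.

(** Integer translations reduce to [b] in [0, 1], and [-4, 4] contains [b - 3, b + 3] for all such
    [b]. *)
Lemma psi_growth_uniform e : 0 < e ->
  exists T, forall b, covers T b (b + e) (b - 3) (b + 3).
Proof.
move=> e0.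
have [||N HN] := @eventually_uniform R (fun b c n => covers n b c (-4) 4) 0 1 e e0.
- by move=> b c b' c' n bb cc /covers_sub; apply.
- by move=> b c; exact: psi_growth.
exists N => b; have [m [u [-> u01]]] := floor_decomp b.
have := HN u N _ (leqnn N) => /(_ ltac:(lra)) /(covers_psiD (m := m)) H.
by apply: (covers_sub H); lra.
Qed.

End lift_expansion.

(** * Growth of intervals under [F], and mixing *)

Section growth.
Context (R : realType) (lam : R) (hlam : 3 < lam).
Implicit Types (x y z s t b c e A B : R) (n k : nat).
Local Notation p := (lam^-1).
Local Notation psi := (psi lam).
Local Notation F := (F lam : R -> R).
Local Notation covers := (covers F).
Local Notation kap := (8^-1 - 3 / 8 * p).

Lemma F_covers b c x y : b <= x <= c -> b <= y <= c -> covers 1 b c (F x) (F y).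
Proof. by move=> bx /(ivt_covers (n := 1) (F_continuous hlam) bx). Qed.

(* As long as no iterate of [b, c] has 0 in its interior, F^n agrees up to sign with
   an iterate of psi on [b, c], and the images under psi^k eventually contain 0. *)
Lemma F_covers_zero b c : b < c -> exists n e, 0 < e /\ covers n b c (- e) e.
Proof.
move=> bc; apply/not_existsP => none.
have signed n : (forall s, b <= s <= c -> iter n F s <= 0) \/
                (forall s, b <= s <= c -> 0 <= iter n F s).
  have [?|] := pselect (forall s, b <= s <= c -> iter n F s <= 0); first by left.
  move=> /existsNP[t /not_implyP[tbc /negP]]; rewrite -ltNge => t0.
  right=> s sbc; rewrite leNgt; apply/negP => s0; apply: (none n).
  have C := ivt_covers (n := n) (F_continuous hlam) sbc tbc.
  have [st|ts] := leP (- iter n F s) (iter n F t).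
    by exists (- iter n F s); split; [lra|apply: (covers_sub C); lra].
  by exists (iter n F t); split; [lra|apply: (covers_sub C); lra].
(* One step of [psi] costs one step of [F] at nonpositive values and two at nonnegative ones, where
   [F] first changes the sign. *)
have key k : exists n, (forall s, b <= s <= c -> iter n F s = iter k psi s) \/
                       (forall s, b <= s <= c -> iter n F s = - iter k psi s).
  elim: k => [|k [n Hn]]; first by exists 0%N; left.
  case: (signed n) => sn.
    exists n.+1; case: Hn => Hn; [right|left] => s sbc; rewrite !iterS F_nonpos ?sn// Hn//.
      by rewrite psiN.
    by rewrite opprK.
  exists n.+2; case: Hn => Hn; [left|right] => s sbc;
    rewrite !iterS (F_nonneg hlam (sn _ sbc)) F_nonpos ?oppr_le0 ?sn// opprK Hn//.
  by rewrite psiN.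
have [N /(_ _ (leqnn N)) HN] := psi_growth hlam 1 bc.
have [|s [sbc s1]] := HN (-1); first lra.
have [|t [tbc t1]] := HN 1; first lra.
have [n Hn] := key N; have := signed n.
by case: Hn => Hn [] sn; have := sn _ sbc; have := sn _ tbc; rewrite !Hn// s1 t1; lra.
Qed.

(** As [F A = - A] and [F (- z) = psi z], one step only extends the interval to [- A, psi z]; the
    second step mirrors the new right end. *)
Lemma F_covers_sym A z : 0 <= z <= A -> A <= psi z ->
  covers 1 (- A) A (- A) A /\ covers 2 (- A) A (- psi z) (psi z).
Proof.
move=> zA Apsi.
have FA := F_nonneg hlam; have Fz : F (- z) = psi z by rewrite F_nonpos ?opprK; lra.
have C1 := @F_covers (- A) A A (- z); rewrite FA ?Fz in C1; last lra.
have C2 := @F_covers (- A) (psi z) (psi z) (- z); rewrite FA ?Fz in C2; last lra.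
split; first by apply: (covers_sub (C1 _ _)); lra.
by apply: (covers_trans (C1 _ _) (C2 _ _)); lra.
Qed.

Lemma covers_around_zero e : 0 < e -> exists n, covers n (- e) e (-1) 1.
Proof.
have [h L P0 PL] := lam_facts hlam.
have large e' : p <= e' -> exists n, covers n (- e') e' (-1) 1.
  move=> pe; have [e1|e1] := leP 1 e'.
    by exists 0%N; apply: (covers_sub (@covers_refl _ F (- e') e')); lra.
  have pp : psi p = 1 by rewrite (psi_a hlam)//; lra.
  have [||_] := @F_covers_sym e' p; rewrite ?pp; try lra.
  by exists 2%N.
have key k : forall e, 0 < e -> p <= 3 ^+ k * e -> exists n, covers n (- e) e (-1) 1.
  elim: k => [|k IH] {}e e0; first by rewrite expr0 mul1r; exact: large.
  have [pe _|ep pk] := leP p e; first exact: large.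
  have le : psi e = lam * e by rewrite (psi_a hlam)//; lra.
  have [||_ C] := @F_covers_sym e e; rewrite ?le; try by [lra|nra].
  have [||n hn] := IH (lam * e); first by nra.
    rewrite (le_trans pk)// exprSr -mulrA ler_pM2l ?exprn_gt0; nra.
  by rewrite le in C; exists (n + 2)%N; apply: covers_trans C hn.
move=> e0; have := archi_boundP (divr_ge0 (ltW P0) (ltW e0)).
set k := Num.bound _; rewrite ltr_pdivrMr// => kb.
apply: (key k) => //; apply: (le_trans (ltW kb)); rewrite ler_pM2r//.
have : k%:R + 1 <= 3 ^+ k :> R by apply: succ_le_exp; lra.
lra.
Qed.

Lemma covers_large A : 1 <= A ->
  covers 1 (- A) A (- A) A /\ covers 2 (- A) A (- (A + kap)) (A + kap).
Proof.
have k0 := kap_gt0 hlam; move=> A1; have [z [zA Ap]] := push_right hlam A.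
have [||C1 C2] := @F_covers_sym A z; try lra.
by split=> //; apply: (covers_sub C2); lra.
Qed.

(** Surplus steps lose nothing, so covering holds at all large times and not only along one
    parity. *)
Lemma covers_stable A n : 1 <= A -> covers n (- A) A (- A) A.
Proof.
move=> A1; elim: n => [|n IH]; first exact: covers_refl.
by apply: (covers_trans (n' := 1) IH); case: (covers_large A1).
Qed.

Lemma covers_outward_zero j :
  covers (j * 2) (-1) 1 (- (1 + j%:R * kap)) (1 + j%:R * kap).
Proof.
have k0 := kap_gt0 hlam; elim: j => [|j IH].
  by rewrite mul0r addr0; exact: covers_refl.
have j0 : 0 <= j%:R * kap by rewrite mulr_ge0// ltW.
have [|_ C] := @covers_large (1 + j%:R * kap); first lra.
rewrite mulSn -[j.+1%:R]natr1; apply: (covers_trans IH); apply: (covers_sub C); lra.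
Qed.

Lemma F_growth b c A : b < c -> exists N, forall n, (N <= n)%N -> covers n b c (- A) A.
Proof.
have k0 := kap_gt0 hlam; move=> bc.
have [n0 [e [e0 h1]]] := F_covers_zero bc.
have [n1 h2] := covers_around_zero e0.
have := archi_boundP (divr_ge0 (normr_ge0 A) (ltW k0)).
set k := Num.bound _; rewrite ltr_pdivrMr// => kb.
have kk0 : 0 <= k%:R * kap by rewrite mulr_ge0// ltW.
have k1 : 1 <= 1 + k%:R * kap by lra.
exists (k * 2 + (n1 + n0))%N => n /subnK <-.
have C := covers_trans (covers_trans (covers_trans h1 h2) (@covers_outward_zero k))
  (@covers_stable _ (n - (k * 2 + (n1 + n0))) k1).
by apply: (covers_sub C); move: (ler_norm A); lra.
Qed.

Lemma F_growth_uniform e lo hi A : 0 < e ->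
  exists N, forall b n, lo <= b <= hi -> (N <= n)%N -> covers n b (b + e) (- A) A.
Proof.
move=> e0; apply: (@eventually_uniform R (fun b c n => covers n b c (- A) A)) => //.
- by move=> b c b' c' n bb cc /covers_sub; apply.
- by move=> b c; exact: F_growth.
Qed.

Lemma F_mixing : @mixing R R^o (Defs.F lam).
Proof.
move=> U V Uo _ [u Uu] [v Vv].
have /nbhs_ballP[e /= e0 eU] : nbhs u U by exact: open_nbhs_nbhs.
have [|N HN] := @F_growth (u - e / 2) (u + e / 2) `|v|; first by lra.
exists N.+1 => // n /ltnW Nn.
have [|x [xu xv]] := HN n Nn v; first by rewrite -ler_norml.
exists v; split => //; exists x => //; apply: eU.
by rewrite /ball/= ltr_norml; lra.
Qed.

End growth.

(** * Segments attached to an orbit: the effect of a fold *)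

Section tracking.
Context (R : realType) (lam : R) (hlam : 3 < lam).
Implicit Types (x y z s t u v w d r tau : R) (m : int) (n k : nat).
Local Notation p := (lam^-1).
Local Notation psi := (psi lam).
Local Notation F := (F lam : R -> R).
Local Notation a := (4^-1 - 3 / 4 * p).

Definition between y w x := y <= x <= w \/ w <= x <= y.

Definition apart r y w := y + r <= w \/ w <= y - r.

(** The turning values of [psi] are the points m + a and m - a, so folded segments land in these
    zones. *)
Definition near_int m x := m%:~R - a <= x <= m%:~R + a.

(** Turning points are more than [a] apart and the slopes are 1 and -1 within distance [a] of them;
    so the segment lies in one lap or is folded as a tent. *)
Lemma psi_fold x1 x2 : x1 <= x2 -> x2 - x1 <= a ->
  apart (x2 - x1) (psi x1) (psi x2) \/
  exists tau (m : int) (up : bool), x1 <= tau <= x2 /\ forall x, x1 <= x <= x2 ->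
    psi x = m%:~R + (-1) ^+ up * (a - `|x - tau|).
Proof.
have [h L P0 PL] := lam_facts hlam; move=> x12 xa.
(* With q1 = 1/4 + p/4 this gives m - q1 <= x1 < m + 1 - q1: one increasing lap followed by one
   decreasing lap. *)
have [m [u [x1E u01]]] := floor_decomp (x1 + (4^-1 + p / 4)).
have [c1|c1] := leP x2 (m%:~R + (4^-1 + p / 4)).
  by left; left; have := @lap_increasing _ _ hlam m _ _ x12; lra.
have [c2|c2] := leP (m%:~R + (4^-1 + p / 4)) x1; last first.
  right; exists (4^-1 + p / 4 + m%:~R), (m + 1), false; split; first lra.
  move=> x xb; rewrite expr0 mul1r intrD -[x in psi x](subrK m%:~R) psiD.
  have [xt|xt] := leP x (4^-1 + p / 4 + m%:~R).
    by rewrite (psi_b hlam) ?ler0_norm; lra.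
  by rewrite (psi_c hlam) ?gtr0_norm; lra.
have [c3|c3] := leP x2 (m%:~R + (3 / 4 - p / 4)).
  by left; right; have := @lap_decreasing _ _ hlam m _ _ x12; lra.
right; exists (3 / 4 - p / 4 + m%:~R), m, true; split; first lra.
move=> x xb; rewrite expr1 mulN1r -[x in psi x](subrK m%:~R) psiD.
have [xt|xt] := leP x (3 / 4 - p / 4 + m%:~R).
  by rewrite (psi_e hlam) ?ler0_norm; lra.
by rewrite (psi_f hlam) ?gtr0_norm; lra.
Qed.

(* If a turning point of [y, w] is within d/3 of y, it is at distance at least 2d/3 from w and
   w1 = w will do; otherwise w1 is the turning point. *)
Lemma psi_track y w d : 0 < d -> d <= a -> w = y + d \/ w = y - d ->
  apart d (psi y) (psi w) \/ exists w1 (m : int), [/\ between y w w1,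
    apart (d / 3) (psi y) (psi w1), near_int m (psi y) & near_int m (psi w1)].
Proof.
move=> d0 da yw.
have fold tau m (up : bool) : between y w tau ->
    (forall x, between y w x -> psi x = m%:~R + (-1) ^+ up * (a - `|x - tau|)) ->
    exists w1 (m : int), [/\ between y w w1,
    apart (d / 3) (psi y) (psi w1), near_int m (psi y) & near_int m (psi w1)].
  move=> yt E.
  have yy : between y w y by rewrite /between; case: yw => ->; [left|right]; lra.
  have ww : between y w w by rewrite /between; case: yw => ->; [left|right]; lra.
  have dist x : between y w x -> `|x - tau| <= d.
    by rewrite ler_norml; case: yw yt => -> [] ? [] ?; lra.
  have near x : between y w x -> near_int m (psi x).
    move=> yx; have := dist x yx; have := normr_ge0 (x - tau).
    by rewrite /near_int E//; case: up {E}; rewrite ?expr1 ?expr0; lra.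
  have sep x : between y w x ->
      `|x - tau| + d / 3 <= `|y - tau| \/ `|y - tau| + d / 3 <= `|x - tau| ->
      apart (d / 3) (psi y) (psi x).
    by move=> yx; rewrite /apart !E//; case: up {E}; rewrite ?expr1 ?expr0 => -[] ?;
      (by left; lra) || (by right; lra).
  have [y3|y3] := leP (d / 3) `|y - tau|.
    exists tau, m; split; [exact: yt| |exact: near|exact: near].
    by apply: sep => //; left; rewrite subrr normr0 add0r.
  exists w, m; split; [exact: ww| |exact: near|exact: near].
  apply: sep => //; right; have : `|w - y| = d.
    by case: yw => ->; rewrite addrAC subrr add0r ?normrN gtr0_norm.
  have := ler_normB (w - tau) (y - tau).
  by rewrite opprB addrA subrK; lra.
case: (yw) => wE.
  have [||[H|H]|[tau [m [up [t1 E]]]]] := @psi_fold y w; try lra.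
  - by left; left; lra.
  - by left; right; lra.
  by right; apply: (fold tau m up); [left|move=> x [] ?; apply: E; lra].
have [||[H|H]|[tau [m [up [t1 E]]]]] := @psi_fold w y; try lra.
- by left; right; lra.
- by left; left; lra.
by right; apply: (fold tau m up); [right|move=> x [] ?; apply: E; lra].
Qed.

End tracking.

(** * Segments close to an integer *)

Section tracking_near.
Context (R : realType) (lam : R) (hlam : 3 < lam).
Implicit Types (x y z s t u v w d r tau : R) (m : int) (n k : nat).
Local Notation p := (lam^-1).
Local Notation psi := (psi lam).
Local Notation F := (F lam : R -> R).
Local Notation a := (4^-1 - 3 / 4 * p).
Local Notation near_int := (near_int lam).

(** In the zone around [m] the map increases, with slope [lam] up to distance [p] and slope 1
    beyond. A segment in the core gains the factor [lam > 3]; one that leaves the core loses no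
    length and lands in the zone of an adjacent integer. *)
Lemma psi_track_near m x1 x2 : x1 <= x2 -> near_int m x1 -> near_int m x2 ->
  lam * (x2 - x1) <= a ->
  3 * (x2 - x1) <= psi x2 - psi x1 \/ (x2 - x1 <= psi x2 - psi x1 /\
    exists m' : int, near_int m' (psi x1) /\ near_int m' (psi x2)).
Proof.
have [h L P0 PL] := lam_facts hlam; rewrite /near_int => x12 n1 n2 la.
have pos y1 y2 : 0 <= y2 -> - p <= y1 -> y1 <= y2 -> y2 <= a -> lam * (y2 - y1) <= a ->
    3 * (y2 - y1) <= psi y2 - psi y1 \/ (y2 - y1 <= psi y2 - psi y1 /\
    exists m' : int, near_int m' (psi y1) /\ near_int m' (psi y2)).
  move=> y20 py1 y12 y2a la'.
  have negE : y1 <= 0 -> psi y1 = lam * y1.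
    by move=> y10; have := psiN hlam y1; rewrite (psi_a hlam (z := - y1)); lra.
  have [y2p|py2] := leP y2 p.
    left; rewrite (psi_a hlam (z := y2)); last lra.
    have [y10|y10] := leP 0 y1; first by rewrite (psi_a hlam); nra.
    by rewrite negE; nra.
  right; rewrite (psi_b hlam (z := y2)); last lra.
  have y10 : 0 <= y1 by nra.
  rewrite /near_int; have [y1p|py1'] := leP y1 p.
    (* Here 1 - lam y1 = lam (p - y1) <= lam (y2 - y1) <= a, so the image of [y1] is in the zone of
       1. *)
    rewrite (psi_a hlam (z := y1)); last lra.
    by split; [nra|exists 1; split; nra].
  rewrite (psi_b hlam (z := y1)); last lra.
  by split; [lra|exists 1; split; lra].
have shift y1 y2 : 3 * (y2 - y1) <= psi y2 - psi y1 \/ (y2 - y1 <= psi y2 - psi y1 /\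
    exists m' : int, near_int m' (psi y1) /\ near_int m' (psi y2)) ->
    3 * (y2 - y1) <= psi (y2 + m%:~R) - psi (y1 + m%:~R) \/
    (y2 - y1 <= psi (y2 + m%:~R) - psi (y1 + m%:~R) /\
    exists m' : int, near_int m' (psi (y1 + m%:~R)) /\ near_int m' (psi (y2 + m%:~R))).
  rewrite !psiD => -[H|[H [m' H']]]; [left; lra|right; split; first lra].
  by exists (m' + m); move: H'; rewrite /near_int intrD => -[]; split; lra.
have refl y1 y2 : 3 * (- y1 - - y2) <= psi (- y1) - psi (- y2) \/
    (- y1 - - y2 <= psi (- y1) - psi (- y2) /\
    exists m' : int, near_int m' (psi (- y2)) /\ near_int m' (psi (- y1))) ->
    3 * (y2 - y1) <= psi y2 - psi y1 \/ (y2 - y1 <= psi y2 - psi y1 /\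
    exists m' : int, near_int m' (psi y1) /\ near_int m' (psi y2)).
  rewrite !(psiN hlam) => -[H|[H [m' H']]]; [left; lra|right; split; first lra].
  by exists (- m'); move: H'; rewrite /near_int mulrNz => -[]; split; lra.
suff /shift : 3 * ((x2 - m%:~R) - (x1 - m%:~R)) <= psi (x2 - m%:~R) - psi (x1 - m%:~R) \/
    ((x2 - m%:~R) - (x1 - m%:~R) <= psi (x2 - m%:~R) - psi (x1 - m%:~R) /\
    exists m' : int, near_int m' (psi (x1 - m%:~R)) /\ near_int m' (psi (x2 - m%:~R))).
  by rewrite !subrK => -[H|[H H']]; [left; lra|right; split; [lra|]].
have {x12} : x1 - m%:~R <= x2 - m%:~R by lra.
have {la} : lam * ((x2 - m%:~R) - (x1 - m%:~R)) <= a by lra.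
have {n1} : - a <= x1 - m%:~R <= a by lra.
have {n2} : - a <= x2 - m%:~R <= a by lra.
move: (x1 - _) (x2 - _) => {}x1 {}x2 n2 n1 la x12.
have [px1|x1p] := leP (- p) x1; have [x20|x20] := leP 0 x2.
- by apply: pos; lra.
- by apply: refl; apply: pos; lra.
- by nra.
- by apply: refl; apply: pos; nra.
Qed.

End tracking_near.

(** * Following an orbit of [F] for one step *)

Section tracking_step.
Context (R : realType) (lam : R) (hlam : 3 < lam).
Implicit Types (x y z s t u v w d r : R) (m : int) (n k : nat).
Local Notation p := (lam^-1).
Local Notation psi := (psi lam).
Local Notation F := (F lam : R -> R).
Local Notation a := (4^-1 - 3 / 4 * p).
Local Notation near_int := (near_int lam).

Lemma between_trans y w w1 x : between y w w1 -> between y w1 x -> between y w x.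
Proof. by rewrite /between => -[?|?] [?|?]; (by left; lra) || (by right; lra). Qed.

Lemma between_ivt f y w v : continuous f -> between (f y) (f w) v ->
  exists x, between y w x /\ f x = v.
Proof.
move=> cf; rewrite /between => fv.
have [yw|wy] := leP y w.
  have [x [xb xv]] : exists x, y <= x <= w /\ f x = v.
    by case: fv; apply: ivt => //; lra.
  by exists x; split=> //; left.
have [x [xb xv]] : exists x, w <= x <= y /\ f x = v.
  by case: fv; apply: ivt => //; lra.
by exists x; split=> //; right.
Qed.

Lemma apart_between r y w : 0 < r -> apart r y w ->
  exists w1, (w1 = y + r \/ w1 = y - r) /\ between y w w1.
Proof.
rewrite /between => r0 -[H|H].
  by exists (y + r); split; left; lra.
by exists (y - r); split; right; lra.
Qed.

Lemma near_int_between m y w x : near_int m y -> near_int m w -> between y w x -> near_int m x.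
Proof. by rewrite /near_int /between => ? ? [?|?]; lra. Qed.

(** On the negative side this is [psi_track] reflected. There is no fold at 0: within distance [p]
    of it, [F] decreases with slope -[lam] on the left and -1 on the right. *)
Lemma F_track y w d : 0 < d -> lam * d <= a -> w = y + d \/ w = y - d ->
  apart d (F y) (F w) \/ exists w1 (m : int), [/\ between y w w1,
    apart (d / 3) (F y) (F w1), near_int m (F y) & near_int m (F w1)].
Proof.
have [h L P0 PL] := lam_facts hlam; move=> d0 da yw.
have dp : d <= p by nra.
have [y0|y0] := leP y 0; have [w0|w0] := leP w 0.
- have [||H|[w1 [m [H1 H2 H3 H4]]]] := @psi_track _ _ hlam (- y) (- w) d d0; first by nra.
  + by case: yw => ->; [right|left]; lra.
  + by left; rewrite !F_nonpos.
  have w10 : - w1 <= 0 by case: H1; lra.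
  right; exists (- w1), m; rewrite !F_nonpos// opprK; split => //.
  by move: H1; rewrite /between => -[?|?]; [right|left]; lra.
- left; rewrite (F_nonpos _ y0) (F_nonneg hlam (ltW w0)) /apart; case: yw => ?; last lra.
  by right; rewrite (psi_a hlam); nra.
- left; rewrite (F_nonpos _ w0) (F_nonneg hlam (ltW y0)) /apart; case: yw => ?; first lra.
  by left; rewrite (psi_a hlam); nra.
left; rewrite !(F_nonneg hlam) ?ltW// /apart.
by case: yw => ?; [right|left]; lra.
Qed.

Lemma F_track_near y w r m : 0 < r -> lam * r <= a -> w = y + r \/ w = y - r ->
  near_int m y -> near_int m w ->
  apart (3 * r) (F y) (F w) \/ (apart r (F y) (F w) /\
    exists m' : int, near_int m' (F y) /\ near_int m' (F w)).
Proof.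
have [h L P0 PL] := lam_facts hlam; move=> r0 ra yw ny nw.
have rp : r <= p by nra.
have [y0|y0] := leP y 0; have [w0|w0] := leP w 0.
- have ny' : near_int (- m) (- y) by move: ny; rewrite /near_int mulrNz; lra.
  have nw' : near_int (- m) (- w) by move: nw; rewrite /near_int mulrNz; lra.
  rewrite !F_nonpos//; case: yw => wE.
    have [||H|[H [m' [H1 H2]]]] := psi_track_near hlam _ nw' ny'; try nra.
      by left; right; lra.
    by right; split; [right; lra|exists m'].
  have [||H|[H [m' [H1 H2]]]] := psi_track_near hlam _ ny' nw'; try nra.
    by left; left; lra.
  by right; split; [left; lra|exists m'].
- rewrite (F_nonpos _ y0) (F_nonneg hlam (ltW w0)) /apart /near_int.
  case: yw => ?; last lra.
  rewrite (psi_a hlam); last lra.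
  by right; split; [right; nra|exists 0; split; nra].
- rewrite (F_nonpos _ w0) (F_nonneg hlam (ltW y0)) /apart /near_int.
  case: yw => ?; first lra.
  rewrite (psi_a hlam); last lra.
  by right; split; [left; nra|exists 0; split; nra].
rewrite !(F_nonneg hlam) ?ltW// /apart; right; split.
  by case: yw => ?; [right|left]; lra.
exists (- m); move: ny nw; rewrite /near_int mulrNz; lra.
Qed.

Definition tracks d y w := (w = y + d \/ w = y - d) \/
  ((w = y + d / 3 \/ w = y - d / 3) /\ exists m, near_int m y /\ near_int m w).

(* A fold costs a factor 3 of length, but lands within distance a of an integer, where
   F has no fold until the next expansion by the factor lam > 3. *)
Lemma tracks_step d y w : 0 < d -> lam * d <= a -> tracks d y w ->
  exists w', tracks d (F y) w' /\
    forall v, between (F y) w' v -> exists x, between y w x /\ F x = v.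
Proof.
have [h L P0 PL] := lam_facts hlam; move=> d0 da yw; have d3 : 0 < d / 3 by lra.
have image w1 w' : between y w w1 -> between (F y) (F w1) w' ->
    forall v, between (F y) w' v -> exists x, between y w x /\ F x = v.
  move=> bw bw' v /(between_trans bw') /(between_ivt (F_continuous hlam))[x [xb <-]].
  by exists x; split=> //; apply: between_trans bw xb.
have yww : between y w w.
  by rewrite /between; case: yw => [[]|[[] ]] *; (by left; lra) || (by right; lra).
case: yw => [yw|[yw [m [ny nw]]]].
  have [H|[w1 [m [yw1 H ny nw]]]] := F_track d0 da yw.
    have [w' [w'E bw']] := apart_between d0 H.
    by exists w'; split; [left|exact: image bw'].
  have [w' [w'E bw']] := apart_between d3 H.
  exists w'; split; last exact: image bw'.
  by right; split=> //; exists m; split=> //; exact: near_int_between bw'.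
have [|||||H|[H [m' [ny' nw']]]] := @F_track_near y w (d / 3) m; try by [lra|].
  rewrite mulrC divfK// in H; have [w' [w'E bw']] := apart_between d0 H.
  by exists w'; split; [left|exact: image bw'].
have [w' [w'E bw']] := apart_between d3 H.
exists w'; split; last exact: image bw'.
by right; split=> //; exists m'; split=> //; exact: near_int_between bw'.
Qed.

End tracking_step.

(** * Shadowing one orbit piece from a compact set *)

Section shadowing.
Context (R : realType) (lam : R) (hlam : 3 < lam).
Implicit Types (x y z s u v w b r : R) (m : int) (n k t : nat).
Local Notation p := (lam^-1).
Local Notation psi := (psi lam).
Local Notation F := (F lam : R -> R).
Local Notation a := (4^-1 - 3 / 4 * p).

Lemma F_flip x : - x - 1 <= F x <= - x + 1.
Proof.
have [x0|x0] := leP x 0; last by rewrite (F_nonneg hlam (ltW x0)); lra.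
by rewrite F_nonpos//; have := psi_dist hlam (- x); rewrite ler_norml; lra.
Qed.

(** Up to an alternating sign, an orbit moves by at most 1 per step; this controls excursions and
    rules out specification on the line. *)
Lemma iter_F_flip n x : x - n%:R <= (-1) ^+ n * iter n F x <= x + n%:R.
Proof.
elim: n => [|n IH]; first by rewrite expr0 mul1r /=; lra.
have := F_flip (iter n F x); rewrite iterS exprS -natr1 mulN1r.
move: IH; rewrite -signr_odd; case: (odd n); rewrite ?expr1 ?expr0; lra.
Qed.

(** In [k] steps of [psi] the point cannot drop below 0, and on nonnegative reals [F] applied twice
    is [psi]. *)
Lemma iter_F_double k x : k%:R <= x -> iter (k * 2) F x = iter k psi x.
Proof.
elim: k => [//|k IH] kx; rewrite -[k.+1%:R]natr1 in kx.
have E : iter (k * 2) F x = iter k psi x by apply: IH; lra.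
have : 0 <= iter k psi x.
  suff : x - k%:R <= iter k psi x by lra.
  elim: (k) => [|j]; first by rewrite subr0.
  by rewrite iterS -natr1; have := psi_dist hlam (iter j psi x); rewrite ler_norml; lra.
by move=> H; rewrite mulSn /= E (F_nonneg hlam H) F_nonpos ?opprK//; lra.
Qed.

Lemma F_natN n : F (- n%:R) = n%:R.
Proof. by rewrite F_nonpos ?oppr_le0// opprK [n%:R]pmulrn psi_int. Qed.

Lemma F_onto_unit n v : n%:R <= v <= n%:R + 1 -> exists x, - n%:R - 1 <= x <= - n%:R /\ F x = v.
Proof.
move=> vn; apply: (@ivt _ F _ _ (- n%:R) (- n.+1%:R)); [exact: F_continuous|lra| |].
  by rewrite -[n.+1%:R]natr1; lra.
by rewrite !F_natN -[n.+1%:R]natr1.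
Qed.

Section orbit_tube.
Context (close : R -> R -> Prop) (d : R) (M1 T : nat) (d0 : 0 < d) (da : lam * d <= a).
Context (close_near : forall u v, `|u - v| <= d -> close u v).
Context (close_right : forall u v, M1%:R <= u -> M1%:R <= v -> close u v).
Context (close_left : forall u v, u <= - M1%:R -> v <= - M1%:R -> close u v).
Context (HT : forall b, covers psi T b (b + d / 3) (b - 3) (b + 3)).

(** The margin 4T + 8 exceeds what an orbit can travel in 2T steps, so an excursion beginning near
    [M2] stays beyond [M1], where [close] is automatic. *)
Let M2 := (M1 + 4 * T + 8)%N.
Let B := (M2 + 4 * T + 8)%N.
Context (y : R).
Local Notation "'y_' n" := (iter n F y) (at level 2, n at level 1).

(** Starting points are confined to [-B, B] so that a preceding orbit piece can be steered onto
    them. *)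
Definition shadow_image n v := exists x, [/\ - B%:R <= x <= B%:R, iter n F x = v &
  forall i, (i <= n)%N -> close (iter i F x) (y_ i)].

Definition follows n := exists w, tracks lam d (y_ n) w /\
  forall v, between (y_ n) w v -> shadow_image n v.

Definition inside n := - M2%:R <= y_ n <= M2%:R /\ follows n.

(** A unit interval waits at [M2] or [- M2] on the side of [y_ n], however far away [y_ n] is. *)
Definition outside n :=
  (M2%:R <= y_ n /\ forall v, M2%:R <= v <= M2%:R + 1 -> shadow_image n v) \/
  (y_ n <= - M2%:R /\ forall v, - M2%:R - 1 <= v <= - M2%:R -> shadow_image n v).

(** The transition from [inside] to [outside]: a short interval taken at the exit grows freely for
    [t] steps, while [follows] is maintained in case the orbit comes back early. *)
Definition excursion n := exists t b, [/\ (t <= 2 * T)%N,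
  M2%:R - 1 <= b <= M2%:R + 2,
  M2%:R <= (-1) ^+ t * y_ n <= M2%:R + 2 + t%:R, follows n &
  forall v, b <= v <= b + d / 3 -> shadow_image n (iter t F v)].

Lemma width_small : d <= 12^-1.
Proof. by have [h L P0 PL] := lam_facts hlam; have d0' := d0; have := da; nra. Qed.

Lemma thresholds : [/\ M2%:R = M1%:R + 4 * T%:R + 8 :> R, B%:R = M2%:R + 4 * T%:R + 8 :> R,
  0 <= M1%:R :> R & 0 <= T%:R :> R].
Proof.
have E n : (n + 4 * T + 8)%:R = n%:R + 4 * T%:R + 8 :> R by rewrite -natrM -!natrD.
by rewrite /B E /M2 E.
Qed.

Lemma shadow_step n v : shadow_image n v -> close (F v) (y_ n.+1) -> shadow_image n.+1 (F v).
Proof.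
move=> [x [xB xv xc]] c; exists x; split=> //; first by rewrite iterS xv.
move=> i; rewrite leq_eqVlt => /predU1P[->|]; last by rewrite ltnS; exact: xc.
by rewrite [iter n.+1 F x]iterS xv.
Qed.

Lemma tracks_close u w v : tracks lam d u w -> between u w v -> close v u.
Proof.
have d0' := d0; move=> uw uwv; apply: close_near; rewrite ler_norml.
by move: uw uwv => [[]|[[]]] ? => [| |_|_] [] ?; lra.
Qed.

Lemma follows_step n : follows n -> follows n.+1.
Proof.
move=> [w [yw wS]]; have [w' [yw' w'S]] := tracks_step hlam d0 da yw.
exists w'; split=> // v yv; have [x [xb xv]] := w'S v yv; rewrite -xv.
apply: shadow_step; first exact: wS.
by rewrite xv; apply: tracks_close yv.
Qed.

Lemma follows_interval n : follows n ->
  exists b, y_ n - d <= b <= y_ n /\ forall v, b <= v <= b + d / 3 -> shadow_image n v.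
Proof.
have d0' := d0; move=> [w [yw wS]].
have [H|H] : w <= y_ n - d / 3 \/ y_ n + d / 3 <= w.
  by case: yw => [[]|[[] ] ] *; (by left; lra) || (by right; lra).
  by exists (y_ n - d / 3); split; [lra|move=> v vb; apply: wS; right; lra].
by exists (y_ n); split; [lra|move=> v vb; apply: wS; left; lra].
Qed.

Lemma excursion_end n b : M2%:R - 1 <= b <= M2%:R + 2 -> M2%:R <= (-1) ^+ (2 * T) * y_ n ->
  (forall v, b <= v <= b + d / 3 -> shadow_image n (iter (2 * T) F v)) -> outside n.
Proof.
have [M2e Be M10 T0] := thresholds; move=> bM; rewrite exprM sqrrN !expr1n mul1r => yM bS.
left; split=> // v vM; have [|x [xb <-]] := HT (b := b) (v := v); first lra.
by rewrite -iter_F_double; [rewrite mulnC; exact: bS|lra].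
Qed.

Lemma inside_step n : inside n -> inside n.+1 \/ excursion n.+1.
Proof.
have [M2e Be M10 T0] := thresholds; have d0' := d0; have d1 := width_small.
move=> [yM /follows_step fn].
have := F_flip (y_ n); rewrite -iterS => yf.
(* The orbit cannot leave to the left: nonnegative points are mirrored exactly, and negative ones go
   above -1. *)
have [y1|y1] := leP (- M2%:R) (y_ n.+1); last first.
  have [yn0|yn0] := leP 0 (y_ n); last lra.
  by move: y1; rewrite iterS (F_nonneg hlam yn0); lra.
have [y2|y2] := leP (y_ n.+1) M2%:R; first by left; split=> //; apply/andP.
right; have [b [yb bS]] := follows_interval fn.
exists 0%N, b; split=> //; [lra|rewrite expr0 mul1r addr0; lra].
Qed.

Lemma outside_step n : outside n -> inside n.+1 \/ outside n.+1.
Proof.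
have [M2e Be M10 T0] := thresholds; have d0' := d0; have d1 := width_small.
move=> [[yM S]|[yM S]].
  have Fy : y_ n.+1 = - y_ n by rewrite iterS (F_nonneg hlam)//; lra.
  right; right; split; first by rewrite Fy; lra.
  move=> v vM; have -> : v = F (- v) by rewrite (F_nonneg hlam) ?opprK//; lra.
  apply: shadow_step; first by apply: S; lra.
  by rewrite (F_nonneg hlam) ?opprK; [apply: close_left; rewrite ?Fy; lra|lra].
have := F_flip (y_ n); rewrite -iterS => yf.
have [y1|y1] := leP M2%:R (y_ n.+1).
  right; left; split=> // v vM; have [x [xb xv]] := F_onto_unit vM; rewrite -xv.
  by apply: shadow_step; [exact: S|apply: close_right; rewrite ?xv; lra].
(* The orbit returns: [y_ n] lies in the waiting interval, and the part between it and -(M2 + 1)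
   covers [y_ n.+1, M2 + 1], so following restarts with length [d]. *)
left; split; first lra.
exists (y_ n.+1 + d); split; first by left; left.
move=> v [vy|?]; last lra.
have [|||x [xb xv]] := @ivt _ F (- M2%:R - 1) (- M2%:R) (y_ n) (- M2.+1%:R) v (F_continuous hlam).
- lra.
- by rewrite -[M2.+1%:R]natr1; lra.
- by rewrite F_natN -iterS -[M2.+1%:R]natr1; lra.
rewrite -xv; apply: shadow_step; first exact: S.
by rewrite xv; apply: close_near; rewrite ler_norml; lra.
Qed.

Lemma excursion_step n : excursion n -> [\/ inside n.+1, outside n.+1 | excursion n.+1].
Proof.
have [M2e Be M10 T0] := thresholds; have d0' := d0; have d1 := width_small.
move=> [t [b [tT bM yM fn bS]]].
move: tT; rewrite leq_eqVlt => /predU1P[tT|tT].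
  subst t; have out : outside n by apply: (excursion_end bM _ bS); lra.
  by case: (outside_step out); [constructor 1|constructor 2].
have := F_flip (y_ n); rewrite -iterS => yf.
have tT' : t.+1%:R <= 2 * T%:R :> R by rewrite -natrM ler_nat.
rewrite -[t.+1%:R]natr1 in tT'.
have t0 : 0 <= t%:R :> R by [].
have yM' : M2%:R - 1 <= (-1) ^+ t.+1 * y_ n.+1 <= M2%:R + 2 + t.+1%:R.
  rewrite exprS mulN1r -natr1; move: yM; rewrite -signr_odd.
  by case: (odd t); rewrite ?expr0 ?expr1; lra.
(* On an early return the growing interval is dropped in favour of the segment kept by [follows]. *)
have [yin|yout] := leP ((-1) ^+ t.+1 * y_ n.+1) M2%:R.
  constructor 1; split; last exact: follows_step.
  by move: yin yM'; rewrite -signr_odd; case: (odd _); rewrite ?expr0 ?expr1; lra.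
constructor 3; exists t.+1, b; split=> //; [lra|exact: follows_step|].
move=> v vb; rewrite iterS; apply: shadow_step; first exact: bS.
have := iter_F_flip t.+1 v; rewrite -iterS -natr1; move: yout.
rewrite -signr_odd; case: (odd _); rewrite ?expr0 ?expr1 => ? ?.
  by apply: close_left; lra.
by apply: close_right; lra.
Qed.

Lemma orbit_states n : [\/ inside n, outside n | excursion n].
Proof.
have [M2e Be M10 T0] := thresholds; have d0' := d0; have d1 := width_small.
elim: n => [|n [/inside_step[]|/outside_step[]|/excursion_step[]]];
  try by [constructor 1|constructor 2|constructor 3].
have S0 v : - B%:R <= v <= B%:R -> close v y -> shadow_image 0 v.
  by move=> vB c; exists v; split=> // i; rewrite leqn0 => /eqP ->.
have [y1|y1] := leP (- M2%:R) y; last first.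
  constructor 2; right; split; first exact: ltW.
  by move=> v vM; apply: S0; [lra|apply: close_left; lra].
have [y2|y2] := leP y M2%:R; last first.
  constructor 2; left; split; first exact: ltW.
  by move=> v vM; apply: S0; [lra|apply: close_right; lra].
constructor 1; split; first by apply/andP.
exists (y + d); split; first by left; left.
by move=> v [] /= ?; apply: S0; try apply: close_near; rewrite ?ler_norml; lra.
Qed.

Lemma shadow_interval n : exists b, - B%:R <= b <= B%:R /\
  forall v, b <= v <= b + d / 3 -> shadow_image n v.
Proof.
have [M2e Be M10 T0] := thresholds; have d0' := d0; have d1 := width_small.
case: (orbit_states n) => [[yM /follows_interval[b [yb bS]]]|[[yM S]|[yM S]]|].
- by exists b; split=> //; lra.
- by exists M2%:R; split=> [|v vM]; [lra|apply: S; lra].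
- by exists (- M2%:R - 1); split=> [|v vM]; [lra|apply: S; lra].
move=> [t [b [tT bM yM /follows_interval[b' [yb bS]] _]]].
exists b'; split=> //.
have tT' : t%:R <= 2 * T%:R :> R by rewrite -natrM ler_nat.
by move: yM; rewrite -signr_odd; case: (odd _); rewrite ?expr0 ?expr1; lra.
Qed.

End orbit_tube.

End shadowing.

(** * Chaining orbit pieces; failure of specification on the line *)

Section chaining.
Context (R : realType) (lam : R) (hlam : 3 < lam).
Implicit Types (x y z s u v w b r : R) (m : int) (n k t : nat).
Local Notation p := (lam^-1).
Local Notation F := (F lam : R -> R).

(** Each shadowed piece ends in an interval of length [d / 3] starting in [-B, B]; after [N] steps
    it covers [-B, B], which contains all starting points for the next piece. *)
Lemma specification_of_close (close : R -> R -> Prop) (delta : R) (M : nat) :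
  0 < delta -> (forall u v, `|u - v| <= delta -> close u v) ->
  (forall u v, M%:R <= u -> M%:R <= v -> close u v) ->
  (forall u v, u <= - M%:R -> v <= - M%:R -> close u v) ->
  exists2 N : nat, (0 < N)%N &
    forall (s : nat) (y : nat -> R) (j k : nat -> nat),
      j 1%N = 0%N ->
      (forall l, (1 <= l <= s)%N -> (j l <= k l)%N) ->
      (forall l, (1 <= l < s)%N -> (k l < j l.+1)%N) ->
      (forall l, (1 <= l < s)%N -> (N <= j l.+1 - k l)%N) ->
      exists x, forall m i : nat, (1 <= m <= s)%N -> (j m <= i <= k m)%N ->
        close (iter i F x) (iter i F (y m)).
Proof.
move=> delta0 near right left; have [h L P0 PL] := lam_facts hlam.
have a0 : 0 < 4^-1 - 3 / 4 * p by lra.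
(* The second bound is a / lam with a = 1/4 - 3p/4, the size below which segments can be
   followed. *)
pose d := Num.min delta ((4^-1 - 3 / 4 * p) * p).
have d0 : 0 < d by rewrite /d lt_min delta0 mulr_gt0.
have da : lam * d <= 4^-1 - 3 / 4 * p.
  by rewrite -ler_pdivlMl ?ge_min 1?[leRHS]mulrC ?lexx ?orbT//; lra.
have dd : d <= delta by rewrite ge_min lexx.
have near' u v : `|u - v| <= d -> close u v by move=> uv; apply: near; exact: le_trans uv dd.
have d3 : 0 < d / 3 by lra.
have [T HT] := psi_growth_uniform hlam d3.
have tube := shadow_interval hlam d0 da near' right left HT.
set B := (M + 4 * T + 8 + 4 * T + 8)%N in tube.
have [N HN] := F_growth_uniform hlam (- B%:R) B%:R B%:R d3.
exists N.+1 => // s y j k j1 jk kj gap.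
have key n : (n < s)%N -> exists b, - B%:R <= b <= B%:R /\ forall v, b <= v <= b + d / 3 ->
    exists x, iter (k n.+1) F x = v /\ forall m i : nat, (1 <= m <= n.+1)%N ->
      (j m <= i <= k m)%N -> close (iter i F x) (iter i F (y m)).
  elim: n => [s0|n IH ns].
    have [b [bB bS]] := tube (y 1%N) (k 1%N).
    exists b; split=> // v /bS[x [_ xv xc]]; exists x; split=> // m i.
    by rewrite -eqn_leq => /eqP <- /andP[_]; exact: xc.
  have [b [bB bS]] := IH (ltnW ns).
  have jk2 := jk n.+2 ns.
  have kj2 := kj n.+1 ns.
  have [b' [bB' bS']] := tube (iter (j n.+2) F (y n.+2)) (k n.+2 - j n.+2)%N.
  exists b'; split=> // v /bS'[x' [x'B <- x'c]].
  (* The gap is long enough to steer some [v'] reached after the previous pieces onto the prescribed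
     start [x']. *)
  have [v' [v'b v'x]] := HN b _ bB (ltnW (gap n.+1 ns)) x' x'B.
  have [x [xv xc]] := bS v' v'b.
  have xj : iter (j n.+2) F x = x'.
    by rewrite -v'x -xv -iterD subnK// ltnW.
  exists x; split; first by rewrite -xj -iterD subnK.
  move=> m i /andP[m1]; rewrite leq_eqVlt => /predU1P[->|mn].
    move=> /andP[ji ik]; rewrite -(subnK ji) !iterD xj.
    by apply: x'c; rewrite leq_sub2r.
  by apply: xc; rewrite m1.
case: s jk kj gap key => [|s] jk kj gap key.
  by exists 0 => m i /andP[m1 m0]; move: (leq_trans m1 m0).
have [b [bB bS]] := key s (ltnSn s).
have [|x [_ xc]] := bS b; first lra.
by exists x.
Qed.

(** With [delta = 1] and gap [N], the points 0 at time 0 and 2N + 2 at time [N] are incompatible: up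
    to sign, [x] is below N + 1 at time [N], while the orbit of 2N + 2 is at least N + 2. *)
Lemma F_no_specification : ~ @specification_property R R^o (Defs.F lam).
Proof.
move=> /(_ 1 ltr01)[N N0 spec].
pose y (l : nat) : R^o := if l == 1%N then 0 else N%:R + N%:R + 2.
pose j (l : nat) := if l == 1%N then 0%N else N.
have l1 l : (1 <= l < 2)%N -> l = 1%N by rewrite ltnS -eqn_leq eq_sym => /eqP.
have [|||||x hx] := spec 2%N y j j; rewrite ?/j//.
- by move=> l /l1 ->.
- by move=> l /l1 ->; rewrite subn0.
have := hx 1%N 0%N isT isT; have := hx 2%N N isT; rewrite leqnn => /(_ isT).
rewrite /mdist /= /y /=.
have := iter_F_flip hlam N x; have := iter_F_flip hlam N (N%:R + N%:R + 2).
rewrite !ltr_norml -signr_odd; case: (odd N); rewrite ?expr0 ?expr1; lra.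
Qed.

End chaining.

(** * A homeomorphism of the line onto (0, 1) *)

Section interval_model.
Context (R : realType).
Implicit Types (x y z u v t : R) (n : nat).

Definition squash x : R := (1 + x / (1 + `|x|)) / 2.

Lemma squash_itv x : squash x \in (`]0, 1[%classic : set R^o).
Proof.
rewrite inE /= in_itv /= /squash; have D : 0 < 1 + `|x| by have := normr_ge0 x; lra.
have : -1 < x / (1 + `|x|) < 1.
  rewrite ltr_pdivlMr// ltr_pdivrMr//; move: (ler_norm x) (ler_norm (- x)).
  by rewrite normrN; lra.
lra.
Qed.

Definition theta (x : R^o) : open_unit_interval R := SigSub (squash_itv x).

Definition theta_inv (t : open_unit_interval R) : R^o :=
  (2 * set_val t - 1) / (1 - `|2 * set_val t - 1|).

Lemma theta_val x : set_val (theta x) = squash x.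
Proof. by []. Qed.

Lemma thetaK : cancel theta theta_inv.
Proof.
move=> x; rewrite /theta_inv theta_val /squash.
have [x0|x0] := leP 0 x.
  have D : 0 < 1 + x by lra.
  rewrite ger0_norm//.
  have -> : 2 * ((1 + x / (1 + x)) / 2) - 1 = x / (1 + x) by field; lra.
  rewrite ger0_norm ?divr_ge0//; last lra.
  by field; rewrite ?subr_eq0; lra.
have D : 0 < 1 - x by lra.
rewrite ltr0_norm//.
have -> : 2 * ((1 + x / (1 - x)) / 2) - 1 = x / (1 - x) by field; lra.
rewrite ltr0_norm ?ltr_pdivrMr ?mul0r//.
by field; lra.
Qed.

Lemma theta_invK : cancel theta_inv theta.
Proof.
move=> t; apply: val_inj; change (set_val (theta (theta_inv t)) = set_val t).
rewrite theta_val /theta_inv /squash.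
have /= : (`]0, 1[%classic : set R^o) (set_val t) by exact: set_valP.
rewrite in_itv /=; move: (set_val t) => {}t t01.
have [x0|x0] := leP 0 (2 * t - 1).
  rewrite (ger0_norm x0) ger0_norm ?divr_ge0//; last lra.
  by field; lra.
rewrite (ltr0_norm x0) ltr0_norm ?ltr_pdivrMr ?mul0r//; last lra.
by field; lra.
Qed.

Lemma squash_lip x y : `|squash x - squash y| <= `|x - y|.
Proof.
wlog xy : x y / x <= y.
  move=> H; have [xy|yx] := leP x y; first exact: H.
  by rewrite distrC [leRHS]distrC; apply: H; exact: ltW.
have A : 1 <= 1 + `|x| by have := normr_ge0 x; lra.
have B : 1 <= 1 + `|y| by have := normr_ge0 y; lra.
have E : squash y - squash x =
    (y * (1 + `|x|) - x * (1 + `|y|)) / (2 * ((1 + `|x|) * (1 + `|y|))).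
  by rewrite /squash; field; lra.
have D : 0 < 2 * ((1 + `|x|) * (1 + `|y|)) by nra.
rewrite distrC [leRHS]distrC [leRHS]ger0_norm ?subr_ge0// E ler_norml.
rewrite ler_pdivrMr// ler_pdivlMr// {E}.
(* The numerator is y - x plus y|x| - x|y|; the latter vanishes for equal signs and is -2xy <= (y -
   x)^2 for x < 0 < y. [K1] and [K2] bound the two terms. *)
have K1 : y - x <= (y - x) * ((1 + `|x|) * (1 + `|y|)) by rewrite ler_peMr; nra.
have K2 : (y - x) * (y - x) <= (y - x) * ((1 + `|x|) * (1 + `|y|)).
  rewrite ler_wpM2l ?subr_ge0//; move: (ler_norm (- x)) (ler_norm y) A B; rewrite normrN; nra.
by move: K1 K2; have [x0|x0] := ger0P x; have [y0|y0] := ger0P y; nra.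
Qed.

Lemma squash_right n x : n%:R <= x -> 1 - n.+1%:R^-1 < squash x < 1.
Proof.
move=> nx; have n0 : 0 <= n%:R :> R by [].
rewrite /squash ger0_norm; last lra.
have -> : (1 + x / (1 + x)) / 2 = 1 - (2 * (1 + x))^-1 by field; lra.
have v0 : 0 < (2 * (1 + x))^-1 by rewrite invr_gt0; lra.
have : (2 * (1 + x))^-1 < n.+1%:R^-1.
  by rewrite ltf_pV2 ?posrE -?[n.+1%:R]natr1; lra.
move: v0; move: (n.+1%:R^-1) (_^-1) => v w; lra.
Qed.

Lemma squashN x : squash (- x) = 1 - squash x.
Proof. by rewrite /squash normrN; have := normr_ge0 x => ?; field; lra. Qed.

Lemma squash_far n x y : (n%:R <= x /\ n%:R <= y) \/ (x <= - n%:R /\ y <= - n%:R) ->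
  `|squash x - squash y| < n.+1%:R^-1.
Proof.
move=> [[nx ny]|[nx ny]].
  have := squash_right nx; have := squash_right ny.
  by move: (n.+1%:R^-1) => v; rewrite ltr_norml; lra.
have nx' : n%:R <= - x by lra.
have ny' : n%:R <= - y by lra.
have := squash_right nx'; have := squash_right ny'.
by move: (n.+1%:R^-1) => v; rewrite !squashN ltr_norml; lra.
Qed.

Lemma mdist_interval (t t' : open_unit_interval R) :
  mdist t t' = `|set_val t' - set_val t|.
Proof. by []. Qed.

Lemma theta_continuous : continuous theta.
Proof.
move=> x; apply/cvg_ballP => e e0; near=> y.
rewrite ballEmdist/= mdist_interval !theta_val distrC.
apply: (le_lt_trans (squash_lip _ _)).
by near: y; exact: cvgr_dist_lt.
Unshelve. all: by end_near. Qed.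

Lemma theta_inv_continuous : continuous theta_inv.
Proof.
pose g (u : R^o) : R^o := (2 * u - 1) / (1 - `|2 * u - 1|).
move=> t; have cv := @initial_continuous _ _ (set_val : open_unit_interval R -> R^o) t.
apply: (@continuous_comp _ _ _ (set_val : open_unit_interval R -> R^o) g); first exact: cv.
have /= : (`]0, 1[%classic : set R^o) (set_val t) by exact: set_valP.
rewrite in_itv /= => {cv} t01; move: (set_val t) t01 => u u01.
have lin : continuous (fun u : R^o => 2 * u - 1 : R^o).
  move=> v; apply: cvgB; last exact: cvg_cst.
  by apply: cvgM; [exact: cvg_cst|exact: cvg_id].
apply: cvgM; first exact: lin.
apply: cvgV; first by rewrite subr_eq0 eq_sym lt_eqF// ltr_norml; lra.
by apply: cvgB; [exact: cvg_cst|apply: cvg_norm; exact: lin].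
Qed.

End interval_model.

(** * Transport of the dynamics from the line to (0, 1) *)

Theorem proposition17 (R : realType) (eps lam : R)
    (heps : 0 < eps) (hlam : 3 < lam) (hln : ln lam < ln 3 + eps) :
  [/\ continuous (F lam),
      mixing (F lam),
      ~ specification_property (F lam) &
      exists f : open_unit_interval R -> open_unit_interval R,
        [/\ continuous f, specification_property f & conjugate f (F lam)]].
Proof.
have cF : continuous (F lam) := F_continuous hlam.
split; [exact: cF|exact: F_mixing|exact: F_no_specification|].
exists (@theta R \o F lam \o @theta_inv R); split.
- move=> t; apply: continuous_comp; first exact: theta_inv_continuous.
  by apply: continuous_comp; [exact: cF|exact: theta_continuous].
- move=> delta delta0.
  have iterf n t : iter n (@theta R \o F lam \o @theta_inv R) t =
      theta (iter n (F lam) (theta_inv t)).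
    by elim: n => [|n /= ->]; rewrite ?theta_invK//= thetaK.
  pose close u v := `|squash v - squash u| < delta.
  (* Halving [delta] turns the non-strict bound on |u - v| into strict closeness. *)
  have d2 : 0 < delta / 2 by lra.
  (* Beyond [M], each tail of the line is squashed to a set of diameter less than [delta]. *)
  set M := Num.bound (1 / delta).
  have M1 : M.+1%:R^-1 < delta.
    have : 1 / delta < M%:R by apply: archi_boundP; rewrite divr_ge0// ltW.
    rewrite ltr_pdivrMr// => dM; rewrite -[M.+1%:R^-1]mul1r ltr_pdivrMr ?ltr0n//.
    by rewrite -natr1; lra.
  have [|u v uM vM|u v uM vM|N N0 spec] := @specification_of_close R lam hlam close (delta / 2) M d2.
  + move=> u v uv; rewrite /close distrC; apply: le_lt_trans (squash_lip _ _) _; lra.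
  + by apply: lt_trans M1; apply: squash_far; left.
  + by apply: lt_trans M1; apply: squash_far; right.
  exists N => // s y j k s2 j1 jk kj gap.
  have [x hx] := spec s (fun l => theta_inv (y l)) j k j1 jk kj gap.
  exists (theta x) => m i ms ji.
  by rewrite mdist_interval !iterf thetaK !theta_val; exact: hx.
exists (@theta R).
  split; first exact: theta_continuous.
  exists (@theta_inv R); split; [exact: theta_inv_continuous|exact: thetaK|exact: theta_invK].
by apply/funext => x /=; rewrite thetaK.
Qed.
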